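(* Let $D=\left(\frac{a,\pi}{K}\right)$ be a quaternion division algebra over $K$ with $a\in\mathcal{O}_K^*$, with $K$-basis $1,x,y,z$ where $x^2=a$, $y^2=\pi$, $z=xy=-yx$, and let $\tau$ be its canonical involution and $\tau_x(d)=x\tau(d)x^{-1}$. Then every skew-hermitian form over $(D,\tau_x)$ is unramified, Larmour's isomorphism is an isomorphism $$\partial_0: W^{-1}\left(\left(\tfrac{a,\pi}{K}\right),\tau_x\right)\cong W^{-1}(k(\overline x),\iota),$$ and for $\alpha\in\mathcal{O}_K^*$ the image of the one-dimensional skew-hermitian form $\langle\alpha x\rangle$ under $\partial_0$ is $\langle\overline\alpha\,\overline x\rangle$.
   Context: $K$ is a complete discretely valued field with normalized valuation $\nu_K$, valuation ring $\mathcal{O}_K$, uniformizer $\pi$ and residue field $k$ of characteristic $\neq2$. $\nu_D(d)=\frac12\nu_K(\mathrm{Nrd}(d))$ extends $\nu_K$ to $D$; $\mathcal{O}_D=\{\nu_D\ge0\}$, $m_D=\{\nu_D>0\}$ (both with $0$), $\overline D=\mathcal{O}_D/m_D$, and a bar denotes reduction modulo $m_D$. Here $\nu_D$ has value group $\frac12\mathbb{Z}$ and $\overline D\cong k(\overline x)$, a quadratic field extension of $k$ with $\overline x^2=\overline a$; $\iota$ is its nontrivial $k$-automorphism. $\tau(x)=-x$, $\tau(y)=-y$, $\tau(z)=-z$; the involution $\tau_x$ induces $\overline{\tau_x}=\iota$ on $\overline D$. $W^\epsilon(E,\rho)$ is the Witt group of nondegenerate $\epsilon$-hermitian forms over a division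 algebra with involution $(E,\rho)$ (skew-hermitian means $\epsilon=-1$), and $\langle u_1,\dots,u_r\rangle$ is the diagonal form with $\rho(u_i)=\epsilon u_i$. A form over $(D,\sigma)$ is unramified if it is isometric to some $\langle u_1,\dots,u_r\rangle$ with all $\nu_D(u_i)=0$; for such a form $h$ put $\overline h=\langle\overline{u_1},\dots,\overline{u_r}\rangle$, an $\epsilon$-hermitian form over $(\overline D,\overline\sigma)$. When every $\epsilon$-hermitian form over $(D,\sigma)$ is unramified, Larmour's isomorphism is the (well-defined) map $\partial_0:W^\epsilon(D,\sigma)\to W^\epsilon(\overline D,\overline\sigma)$, $[h]\mapsto[\overline h]$. *)

(* Defs.v *)
From HB Require Import structures.
From mathcomp Require Import all_boot all_order all_algebra.
From mathcomp Require Import boolp.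
From mathcomp Require Import ring.

Set Implicit Arguments.
Unset Strict Implicit.
Unset Printing Implicit Defensive.

Import Order.TTheory GRing.Theory Num.Theory.
Local Open Scope ring_scope.
Import VectorInternalTheory.
Local Open Scope quotient_scope.

Definition division_ring (R : nzRingType) : Prop :=
  forall x : R, x != 0 -> exists y : R, x * y = 1 /\ y * x = 1.

Record invDivRing := InvDivRing {
  idr_sort :> nzRingType;
  idr_div : division_ring idr_sort;
  star : idr_sort -> idr_sort;
  starD : {morph star : x y / x + y};
  starM : forall x y, star (x * y) = star y * star x;
  starK : involutive star
}.

Section StarTheory.
Variable E : invDivRing.
Implicit Types x y : E.

Lemma star0 : star (0 : E) = 0.
Proof. by apply: (addrI (star 0)); rewrite -starD !addr0. Qed.

Lemma star_eq0 x : (star x == 0) = (x == 0).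
Proof. by rewrite -{1}star0 (inj_eq (can_inj (@starK E))). Qed.

Lemma starN x : star (- x) = - star x.
Proof. by apply: (addrI (star x)); rewrite -starD !subrr star0. Qed.

Lemma star1 : star (1 : E) = 1.
Proof. by rewrite -[LHS]mulr1 -{2}[1]starK -starM mulr1 starK. Qed.

Lemma star_sum n (F : 'I_n -> E) : star (\sum_i F i) = \sum_i star (F i).
Proof. by apply: (big_morph (@star E) (@starD E) star0). Qed.

Lemma star_sign (b : bool) : star ((-1) ^+ b : E) = (-1) ^+ b.
Proof. by case: b; rewrite ?expr0 ?expr1 ?starN star1. Qed.

Lemma idr_mulf_eq0l x y : y != 0 -> x * y = 0 -> x = 0.
Proof.
move=> /idr_div[z [yz _]] xy0.
by rewrite -[x]mulr1 -yz mulrA xy0 mul0r.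
Qed.
End StarTheory.

(* A nondegenerate eps-hermitian space is a finite-dimensional left E-vector
   space with a form linear in its first variable; semilinearity in the second
   variable, h u (a *: v) = h u v * star a, follows from the symmetry.
   The sign is (-1) ^+ eps: eps = true means skew-hermitian. *)
Record hform (E : invDivRing) (eps : bool) := HForm {
  hspace : vectType E;
  hval :> hspace -> hspace -> E;
  hlinear : forall a u v w, hval (a *: u + v) w = a * hval u w + hval v w;
  hsym : forall u v, hval v u = (-1) ^+ eps * star (hval u v);
  hnondeg : forall u, (forall v, hval u v = 0) -> u = 0
}.

Section Forms.
Variables (E : invDivRing) (eps : bool).
Notation form := (hform E eps).
Implicit Types h m : form.

Lemma hDl h u v w : h (u + v) w = h u w + h v w.
Proof. by rewrite -{1}[u]scale1r hlinear mul1r. Qed.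

Lemma h0l h w : h 0 w = 0.
Proof. by apply: (addrI (h 0 w)); rewrite -hDl !addr0. Qed.

Lemma hNl h u w : h (- u) w = - h u w.
Proof. by apply: (addrI (h u w)); rewrite -hDl !subrr h0l. Qed.

Lemma hDr h u v w : h w (u + v) = h w u + h w v.
Proof. by rewrite !(hsym _ w) hDl starD mulrDr. Qed.

Lemma h0r h w : h w 0 = 0.
Proof. by rewrite hsym h0l star0 mulr0. Qed.

Lemma hNr h u w : h w (- u) = - h w u.
Proof. by apply: (addrI (h w u)); rewrite -hDr !subrr h0r. Qed.

Definition isometric h h' : Prop :=
  exists f : {linear hspace h -> hspace h'},
    bijective f /\ forall u v, h' (f u) (f v) = h u v.

Lemma isometric_refl h : isometric h h.
Proof. by exists idfun; split=> //; exists id. Qed.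

Lemma isometric_sym h h' : isometric h h' -> isometric h' h.
Proof.
case=> f [[g fK gK] fh].
have gl : linear g by move=> a u v; apply: (can_inj fK); rewrite linearP !gK.
pose gL := HB.pack_for {linear hspace h' -> hspace h} g
  (GRing.isLinear.Build _ _ _ _ g gl).
exists gL; split; first by exists f.
by move=> u v; rewrite -fh /= !gK.
Qed.

Lemma isometric_trans h2 h1 h3 :
  isometric h1 h2 -> isometric h2 h3 -> isometric h1 h3.
Proof.
case=> f [fb fh] [g [gb gh]].
exists (g \o f : {linear _ -> _}); split; first exact: bij_comp.
by move=> u v; rewrite /= gh fh.
Qed.

Section Sum.
Variables h1 h2 : form.
Let V := (hspace h1 * hspace h2)%type : vectType E.
Definition hsum_val (u v : V) : E := h1 u.1 v.1 + h2 u.2 v.2.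

Fact hsum_linear a u v w :
  hsum_val (a *: u + v) w = a * hsum_val u w + hsum_val v w.
Proof. by rewrite /hsum_val /= !hlinear mulrDr addrACA. Qed.

Fact hsum_sym u v : hsum_val v u = (-1) ^+ eps * star (hsum_val u v).
Proof. by rewrite /hsum_val (hsym u.1) (hsym u.2) starD mulrDr. Qed.

Fact hsum_nondeg u : (forall v, hsum_val u v = 0) -> u = 0.
Proof.
case: u => u1 u2 u0; congr pair; apply: hnondeg => v.
  by have := u0 (v, 0); rewrite /hsum_val /= h0r addr0.
by have := u0 (0, v); rewrite /hsum_val /= h0r add0r.
Qed.

Definition hsum : form := HForm hsum_linear hsum_sym hsum_nondeg.
End Sum.

Section Opp.
Variable h : form.
Definition hopp_val (u v : hspace h) : E := - h u v.

Fact hopp_linear a u v w :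
  hopp_val (a *: u + v) w = a * hopp_val u w + hopp_val v w.
Proof. by rewrite /hopp_val hlinear opprD mulrN. Qed.

Fact hopp_sym u v : hopp_val v u = (-1) ^+ eps * star (hopp_val u v).
Proof. by rewrite /hopp_val hsym starN mulrN. Qed.

Fact hopp_nondeg u : (forall v, hopp_val u v = 0) -> u = 0.
Proof.
by move=> u0; apply: hnondeg => v; apply: oppr_inj; rewrite oppr0 -(u0 v).
Qed.

Definition hopp : form := HForm hopp_linear hopp_sym hopp_nondeg.
End Opp.

Definition diag_ok (u : seq E) : Prop :=
  forall c, c \in u -> c != 0 /\ star c = (-1) ^+ eps * c.

Section Diag.
Variables (u : seq E) (u_ok : diag_ok u).

Definition hdiag_val (v w : 'rV[E]_(size u)) : E :=
  \sum_(i < size u) v 0 i * u`_i * star (w 0 i).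

Fact hdiag_linear a v v' w :
  hdiag_val (a *: v + v') w = a * hdiag_val v w + hdiag_val v' w.
Proof.
rewrite /hdiag_val mulr_sumr -big_split; apply: eq_bigr => i _ /=.
by rewrite !mxE !mulrDl !mulrA.
Qed.

Fact hdiag_sym v w : hdiag_val w v = (-1) ^+ eps * star (hdiag_val v w).
Proof.
rewrite /hdiag_val star_sum mulr_sumr; apply: eq_bigr => i _.
rewrite !starM starK (proj2 (u_ok (mem_nth 0 (ltn_ord i)))).
by case: (eps); rewrite ?expr1 ?expr0 ?mulN1r ?mul1r ?(mulrN, mulNr) ?opprK !mulrA.
Qed.

Fact hdiag_nondeg v : (forall w, hdiag_val v w = 0) -> v = 0.
Proof.
move=> v0; apply/rowP=> j; rewrite mxE.
have := v0 (delta_mx 0 j); rewrite /hdiag_val (bigD1 j) //= big1 => [|i ij].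
  rewrite mxE !eqxx star1 mulr1 addr0; apply: idr_mulf_eq0l.
  exact: (proj1 (u_ok (mem_nth 0 (ltn_ord j)))).
by rewrite mxE (negPf ij) andbF star0 mulr0.
Qed.

Definition hdiag : form := HForm hdiag_linear hdiag_sym hdiag_nondeg.
End Diag.

Fact diag_ok_nil : diag_ok [::]. Proof. by []. Qed.
Definition hzero : form := hdiag diag_ok_nil.

(* A subset equal to its own orthogonal is automatically a subspace, so L is a
   Lagrangian. When 2 is invertible in E, metabolic spaces are exactly the
   hyperbolic ones. *)
Definition metabolic h : Prop :=
  exists L : hspace h -> Prop,
    forall u, L u <-> (forall v, L v -> h u v = 0).

Definition witt_equiv h h' : Prop :=
  exists m m', [/\ metabolic m, metabolic m' &
                   isometric (hsum h m) (hsum h' m')].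

Lemma metabolic_hzero : metabolic hzero.
Proof.
exists (fun=> True) => u; split=> // _ v _.
by rewrite /= /hdiag_val big_ord0.
Qed.

Lemma metabolic_hsum h h' : metabolic h -> metabolic h' -> metabolic (hsum h h').
Proof.
case=> L HL [L' HL']; exists (fun u => L u.1 /\ L' u.2) => -[u u'] /=; split.
  case=> Lu Lu' [v v'] [/= Lv Lv'].
  by rewrite /hsum_val /= (HL u).1 // (HL' u').1 // addr0.
have L0 : L 0 by apply/HL => v _; rewrite h0l.
have L'0 : L' 0 by apply/HL' => v _; rewrite h0l.
move=> uu'; split; [apply/HL=> v Lv|apply/HL'=> v Lv].
  by have := uu' (v, 0) (conj Lv L'0); rewrite /hsum_val /= h0r addr0.
by have := uu' (0, v) (conj L0 Lv); rewrite /hsum_val /= h0r add0r.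
Qed.

Lemma metabolic_hopp h : metabolic (hsum (hopp h) h).
Proof.
exists (fun u => u.1 = u.2) => -[u u'] /=; split.
  by move=> -> [v v'] /= ->; rewrite /hsum_val /= /hopp_val addNr.
move=> uu'; apply/eqP; rewrite eq_sym -subr_eq0; apply/eqP.
apply: (@hnondeg _ _ h) => v; have := uu' (v, v) erefl.
by rewrite /hsum_val /= /hopp_val addrC hDl hNl.
Qed.

Lemma isometric_hsum h1 h1' h2 h2' : isometric h1 h1' -> isometric h2 h2' ->
  isometric (hsum h1 h2) (hsum h1' h2').
Proof.
case=> f [[f' fK f'K] fh] [g [[g' gK g'K] gh]].
pose F (u : hspace h1 * hspace h2) := (f u.1, g u.2).
have Fl : linear F by move=> a u v; rewrite /F /= !linearP.
pose FL := HB.pack_for {linear hspace (hsum h1 h2) -> hspace (hsum h1' h2')} F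
  (GRing.isLinear.Build _ _ _ _ F Fl).
exists FL; split.
  by exists (fun u => (f' u.1, g' u.2)) => -[u v]; rewrite /= /F /= ?fK ?gK ?f'K ?g'K.
by move=> u v; rewrite /= /hsum_val /= fh gh.
Qed.

Lemma isometric_hsumC h1 h2 : isometric (hsum h1 h2) (hsum h2 h1).
Proof.
pose F (u : hspace h1 * hspace h2) := (u.2, u.1).
have Fl : linear F by [].
pose FL := HB.pack_for {linear hspace (hsum h1 h2) -> hspace (hsum h2 h1)} F
  (GRing.isLinear.Build _ _ _ _ F Fl).
exists FL; split; first by exists (fun u => (u.2, u.1)) => -[].
by move=> u v; rewrite /= /hsum_val /= addrC.
Qed.

Lemma isometric_hsumA h1 h2 h3 :
  isometric (hsum h1 (hsum h2 h3)) (hsum (hsum h1 h2) h3).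
Proof.
pose F (u : hspace h1 * (hspace h2 * hspace h3)) := (u.1, u.2.1, u.2.2).
have Fl : linear F by [].
pose FL := HB.pack_for
  {linear hspace (hsum h1 (hsum h2 h3)) -> hspace (hsum (hsum h1 h2) h3)} F
  (GRing.isLinear.Build _ _ _ _ F Fl).
exists FL; split; first by exists (fun u => (u.1.1, (u.1.2, u.2))) => [[? []]|[[]]].
by move=> u v; rewrite /= /hsum_val /= /hsum_val /= addrA.
Qed.

Lemma isometric_hsum0 h : isometric (hsum hzero h) h.
Proof.
pose F (u : hspace hzero * hspace h) := u.2.
have Fl : linear F by [].
pose FL := HB.pack_for {linear hspace (hsum hzero h) -> hspace h} F
  (GRing.isLinear.Build _ _ _ _ F Fl).
exists FL; split.
  exists (fun u => (0, u)) => // -[u v]; congr pair.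
  by apply/rowP=> -[].
by move=> u v; rewrite /= /hsum_val /= /hdiag_val big_ord0 add0r.
Qed.

Lemma isometric_hsumACA h1 h2 h3 h4 :
  isometric (hsum (hsum h1 h2) (hsum h3 h4)) (hsum (hsum h1 h3) (hsum h2 h4)).
Proof.
apply: isometric_trans (isometric_sym (isometric_hsumA _ _ _)) _.
apply: isometric_trans (isometric_hsumA _ _ _).
apply: isometric_hsum (isometric_refl _) _.
apply: isometric_trans (isometric_hsumA _ _ _) _.
apply: isometric_trans (isometric_sym (isometric_hsumA _ _ _)).
exact: isometric_hsum (isometric_hsumC _ _) (isometric_refl _).
Qed.

Lemma witt_equiv_isometric h h' : isometric h h' -> witt_equiv h h'.
Proof.
move=> hh'; exists hzero, hzero; split; try exact: metabolic_hzero.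
exact: isometric_hsum hh' (isometric_refl _).
Qed.

Lemma witt_equiv_sym h h' : witt_equiv h h' -> witt_equiv h' h.
Proof. by case=> m [m' [? ? /isometric_sym ?]]; exists m', m; split. Qed.

Lemma witt_equiv_trans h2 h1 h3 :
  witt_equiv h1 h2 -> witt_equiv h2 h3 -> witt_equiv h1 h3.
Proof.
case=> m [m' [Hm Hm' i1]] [n [n' [Hn Hn' i2]]].
exists (hsum m n), (hsum n' m'); split; try exact: metabolic_hsum.
apply: isometric_trans (isometric_hsumA _ _ _) _.
apply: isometric_trans (isometric_hsum i1 (isometric_refl _)) _.
apply: isometric_trans (isometric_sym (isometric_hsumA _ _ _)) _.
apply: isometric_trans (isometric_hsum (isometric_refl _) (isometric_hsumC _ _)) _.
apply: isometric_trans (isometric_hsumA _ _ _) _.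
apply: isometric_trans (isometric_hsum i2 (isometric_refl _)) _.
exact: isometric_sym (isometric_hsumA _ _ _).
Qed.

Lemma witt_equiv_hsum h1 h1' h2 h2' : witt_equiv h1 h1' -> witt_equiv h2 h2' ->
  witt_equiv (hsum h1 h2) (hsum h1' h2').
Proof.
case=> m [m' [Hm Hm' i1]] [n [n' [Hn Hn' i2]]].
exists (hsum m n), (hsum m' n'); split; try exact: metabolic_hsum.
apply: isometric_trans (isometric_hsumACA _ _ _ _) _.
apply: isometric_trans (isometric_hsumACA _ _ _ _).
exact: isometric_hsum.
Qed.

Lemma witt_equiv_metabolic h : metabolic h -> witt_equiv h hzero.
Proof.
move=> Hh; exists hzero, h; split=> //; first exact: metabolic_hzero.
exact: isometric_hsumC.
Qed.

Lemma isometric_hopp h h' : isometric h h' -> isometric (hopp h) (hopp h').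
Proof. by case=> f [fb fh]; exists f; split=> // u v; rewrite /= /hopp_val fh. Qed.

Lemma metabolic_opp h : metabolic h -> metabolic (hopp h).
Proof.
case=> L HL; exists L => u; split=> [Lu v Lv|H].
  by rewrite /= /hopp_val (HL u).1 // oppr0.
by apply/HL => v /H /=; rewrite /hopp_val => /eqP; rewrite oppr_eq0 => /eqP.
Qed.

Lemma isometric_hopp_hsum h h' :
  isometric (hopp (hsum h h')) (hsum (hopp h) (hopp h')).
Proof.
exists (idfun : {linear _ -> _}); split; first by exists id.
by move=> u v; rewrite /= /hopp_val /hsum_val /= /hopp_val opprD.
Qed.

Lemma witt_equiv_hopp h h' : witt_equiv h h' -> witt_equiv (hopp h) (hopp h').
Proof.
case=> m [m' [Hm Hm' i]]; exists (hopp m), (hopp m'); split.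
- exact: metabolic_opp.
- exact: metabolic_opp.
apply: isometric_trans (isometric_sym (isometric_hopp_hsum _ _)) _.
apply: isometric_trans (isometric_hopp_hsum _ _).
exact: isometric_hopp.
Qed.

(* Every space is isometric to one on some E^n; such spaces form a set, whose
   quotient by Witt equivalence is the Witt group. *)
Record cform := CForm {
  cdim : nat;
  cval : 'rV[E]_cdim -> 'rV[E]_cdim -> E;
  clinear : forall a u v w, cval (a *: u + v) w = a * cval u w + cval v w;
  csym : forall u v, cval v u = (-1) ^+ eps * star (cval u v);
  cnondeg : forall u, (forall v, cval u v = 0) -> u = 0
}.

Definition hform_of_cform (c : cform) : form :=
  HForm (@clinear c) (@csym c) (@cnondeg c).

Section Coord.
Variable h : form.
Local Notation n := (dim (hspace h)).
Definition coord_val (u v : 'rV[E]_n) : E := h (r2v u) (r2v v).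

Fact coord_linear a u v w :
  coord_val (a *: u + v) w = a * coord_val u w + coord_val v w.
Proof. by rewrite /coord_val linearP hlinear. Qed.

Fact coord_sym u v : coord_val v u = (-1) ^+ eps * star (coord_val u v).
Proof. exact: hsym. Qed.

Fact coord_nondeg u : (forall v, coord_val u v = 0) -> u = 0.
Proof.
move=> u0; apply: (can_inj r2vK); rewrite linear0; apply: hnondeg => v.
by rewrite -[v]v2rK; apply: u0.
Qed.

Definition cform_of_hform : cform :=
  CForm coord_linear coord_sym coord_nondeg.

Lemma cform_of_hformK : isometric (hform_of_cform cform_of_hform) h.
Proof.
exists (r2v : {linear _ -> _}); split=> //.
by exists v2r; [exact: r2vK|exact: v2rK].
Qed.
End Coord.

HB.instance Definition _ := gen_eqMixin cform.
HB.instance Definition _ := gen_choiceMixin cform.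

Definition witt_rel : rel cform :=
  fun c c' => `[< witt_equiv (hform_of_cform c) (hform_of_cform c') >].

Fact witt_rel_equiv : equiv_class_of witt_rel.
Proof.
split=> [c|c c'|c2 c1 c3].
- exact/asboolP/witt_equiv_isometric/isometric_refl.
- by apply/asboolP/asboolP => /witt_equiv_sym.
- by move=> /asboolP h12 /asboolP h23; apply/asboolP/(witt_equiv_trans h12).
Qed.

Canonical witt_equiv_rel := EquivRelPack witt_rel_equiv.
Canonical witt_enc_rel := defaultEncModRel witt_rel.

Definition Witt := {eq_quot witt_rel}.
HB.instance Definition _ := EqQuotient.on Witt.
HB.instance Definition _ := Choice.on Witt.

Definition witt_class (h : form) : Witt := \pi_Witt (cform_of_hform h).
Definition witt_repr (w : Witt) : form := hform_of_cform (repr w).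

Lemma witt_classP h h' : witt_class h = witt_class h' <-> witt_equiv h h'.
Proof.
have cE h1 : witt_equiv (hform_of_cform (cform_of_hform h1)) h1.
  exact/witt_equiv_isometric/cform_of_hformK.
split=> [/eqmodP/asboolP e|e].
  apply: witt_equiv_trans (witt_equiv_sym (cE h)) _.
  exact: witt_equiv_trans e (cE h').
apply/eqmodP/asboolP; apply: witt_equiv_trans (cE h) _.
exact: witt_equiv_trans e (witt_equiv_sym (cE h')).
Qed.

Lemma witt_reprK w : witt_class (witt_repr w) = w.
Proof.
rewrite -[RHS]reprK; apply/eqmodP/asboolP/witt_equiv_isometric.
exact: cform_of_hformK.
Qed.

Lemma witt_ind (P : Witt -> Prop) : (forall h, P (witt_class h)) -> forall w, P w.
Proof. by move=> HP w; rewrite -(witt_reprK w). Qed.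

Definition witt_add (w w' : Witt) : Witt :=
  witt_class (hsum (witt_repr w) (witt_repr w')).
Definition witt_opp (w : Witt) : Witt := witt_class (hopp (witt_repr w)).

Lemma witt_equiv_repr h : witt_equiv (witt_repr (witt_class h)) h.
Proof. by apply/witt_classP; rewrite witt_reprK. Qed.

Lemma witt_addE h h' :
  witt_add (witt_class h) (witt_class h') = witt_class (hsum h h').
Proof. by apply/witt_classP/witt_equiv_hsum; apply: witt_equiv_repr. Qed.

Lemma witt_oppE h : witt_opp (witt_class h) = witt_class (hopp h).
Proof. by apply/witt_classP/witt_equiv_hopp/witt_equiv_repr. Qed.

Fact witt_addA : associative witt_add.
Proof.
elim/witt_ind=> h1; elim/witt_ind=> h2; elim/witt_ind=> h3.
by rewrite !witt_addE; apply/witt_classP/witt_equiv_isometric/isometric_hsumA.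
Qed.

Fact witt_addC : commutative witt_add.
Proof.
elim/witt_ind=> h1; elim/witt_ind=> h2.
by rewrite !witt_addE; apply/witt_classP/witt_equiv_isometric/isometric_hsumC.
Qed.

Fact witt_add0 : left_id (witt_class hzero) witt_add.
Proof.
elim/witt_ind=> h.
by rewrite witt_addE; apply/witt_classP/witt_equiv_isometric/isometric_hsum0.
Qed.

Fact witt_addN : left_inverse (witt_class hzero) witt_opp witt_add.
Proof.
elim/witt_ind=> h; rewrite witt_oppE witt_addE.
exact/witt_classP/witt_equiv_metabolic/metabolic_hopp.
Qed.

HB.instance Definition _ :=
  GRing.isZmodule.Build Witt witt_addA witt_addC witt_add0 witt_addN.

End Forms.

(* The value at 0 is a dummy; 0 is added by hand wherever {v >= q} is meant. *)
Record valuation (R : nzRingType) := Valuation {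
  vfun :> R -> rat;
  vM : forall x y, x != 0 -> y != 0 -> vfun (x * y) = vfun x + vfun y;
  vD : forall x y, x != 0 -> y != 0 -> x + y != 0 ->
         Num.min (vfun x) (vfun y) <= vfun (x + y)
}.

Definition vge (R : nzRingType) (v : R -> rat) (q : rat) (x : R) : bool :=
  (x == 0) || (q <= v x).

Definition normalized (R : nzRingType) (v : R -> rat) : Prop :=
  forall q : rat, (exists2 x, x != 0 & v x = q) <-> q \is a Num.int.

Definition valuation_complete (R : nzRingType) (v : R -> rat) : Prop :=
  forall u : nat -> R,
    (forall N : nat, exists n0, forall m n,
        (n0 <= m)%N -> (n0 <= n)%N -> vge v N%:R (u m - u n)) ->
    exists l, forall N : nat, exists n0, forall n,
        (n0 <= n)%N -> vge v N%:R (u n - l).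

Section ValuationTheory.
Variables (R : nzRingType) (v : valuation R).
Implicit Types x y : R.

Lemma v1 : v 1 = 0.
Proof.
by apply: (addrI (v 1)); rewrite -vM ?oner_neq0 // mulr1 addr0.
Qed.

Lemma vN1 : v (- 1) = 0.
Proof.
have N1 : (-1 : R) != 0 by rewrite oppr_eq0 oner_neq0.
apply/eqP; have /eqP := vM v N1 N1.
by rewrite mulrNN mulr1 v1 -mulr2n eq_sym mulrn_eq0.
Qed.

Lemma vN x : v (- x) = v x.
Proof.
have [->|x0] := eqVneq x 0; first by rewrite oppr0.
by rewrite -mulN1r vM ?oppr_eq0 ?oner_neq0 // vN1 add0r.
Qed.

Lemma vgeN q x : vge v q (- x) = vge v q x.
Proof. by rewrite /vge oppr_eq0 vN. Qed.

Lemma vgeD q x y : vge v q x -> vge v q y -> vge v q (x + y).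
Proof.
have [->|x0] := eqVneq x 0; first by rewrite add0r.
have [->|y0] := eqVneq y 0; first by rewrite addr0.
rewrite /vge (negPf x0) (negPf y0) /= => qx qy.
have [//|xy0] := eqVneq (x + y) 0.
by apply: le_trans (vD v x0 y0 xy0); rewrite le_min qx.
Qed.

Lemma vgeM q r x y : vge v q x -> vge v r y -> vge v (q + r) (x * y).
Proof.
have [->|x0] := eqVneq x 0; first by rewrite mul0r /vge eqxx.
have [->|y0] := eqVneq y 0; first by rewrite mulr0 /vge eqxx.
rewrite /vge (negPf x0) (negPf y0) /= => qx qy.
by rewrite vM // lerD // orbT.
Qed.

Lemma vgeW q r x : r <= q -> vge v q x -> vge v r x.
Proof.
by move=> rq /orP[x0|/(le_trans rq) h]; rewrite /vge ?x0 // h orbT.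
Qed.

Definition vring : {pred R} := [pred x | vge v 0 x].

Fact vring_subring : subring_closed vring.
Proof.
split; first by rewrite inE /vge v1 lexx orbT.
  by move=> x y; rewrite !inE => vx vy; rewrite vgeD ?vgeN.
by move=> x y; rewrite !inE => vx vy; rewrite -[0]addr0 vgeM.
Qed.
HB.instance Definition _ := GRing.isSubringClosed.Build R vring vring_subring.

Record vring_type := VRing { vring_val :> R; _ : vring_val \in vring }.
HB.instance Definition _ := [isSub for vring_val].
HB.instance Definition _ := [Choice of vring_type by <:].
HB.instance Definition _ := [SubChoice_isSubNzRing of vring_type by <:].

Definition vmax : {pred vring_type} :=
  [pred x | (val x == 0) || (0 < v (val x))].

Lemma vmaxP (x : vring_type) :
  reflect (exists2 q, 0 < q & vge v q (val x)) (x \in vmax).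
Proof.
apply: (iffP orP) => [[/eqP x0|x0]|[q q0 /orP[/eqP->|qx]]].
- by exists 1; rewrite ?ltr01 // /vge x0 eqxx.
- by exists (v (val x)); rewrite // /vge lexx orbT.
- by left.
- by right; apply: lt_le_trans qx.
Qed.

Fact vmax_zmod : zmod_closed vmax.
Proof.
split; first by rewrite inE /= eqxx.
move=> x y /vmaxP[q q0 xq] /vmaxP[r r0 yr]; apply/vmaxP.
exists (Num.min q r); first by rewrite lt_min q0.
rewrite raddfB vgeD ?vgeN //; [apply: vgeW xq|apply: vgeW yr];
  by rewrite ge_min lexx ?orbT.
Qed.
HB.instance Definition _ := GRing.isZmodClosed.Build vring_type vmax vmax_zmod.

Lemma vmaxMl (x y : vring_type) : y \in vmax -> x * y \in vmax.
Proof.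
move=> /vmaxP[q q0 yq]; apply/vmaxP; exists q => //.
by rewrite rmorphM -[q]add0r vgeM //; apply: valP.
Qed.

Lemma vmaxMr (x y : vring_type) : x \in vmax -> x * y \in vmax.
Proof.
move=> /vmaxP[q q0 yq]; apply/vmaxP; exists q => //.
by rewrite rmorphM -[q]addr0 vgeM //; apply: valP.
Qed.

Definition residue := Quotient.quot vmax.
HB.instance Definition _ := GRing.Zmodule.on residue.

Local Notation pi x := (\pi_residue x).

Lemma residue_ind (P : residue -> Prop) :
  (forall x : vring_type, P (pi x)) -> forall t, P t.
Proof. by move=> HP t; rewrite -[t]reprK. Qed.

Lemma residue_eqE (x y : vring_type) : (pi x == pi y) = (x - y \in vmax).
Proof. exact: (esym (Quotient.idealrBE _ _ _)). Qed.

Definition residue_one : residue := pi 1.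
Definition residue_mul (s t : residue) : residue := pi (repr s * repr t).

Lemma residue_reprB (x : vring_type) : repr (pi x) - x \in vmax.
Proof. by rewrite -residue_eqE reprK. Qed.

Lemma residue_mulE (x y : vring_type) : residue_mul (pi x) (pi y) = pi (x * y).
Proof.
apply/eqP; rewrite residue_eqE.
have -> : repr (pi x) * repr (pi y) - x * y =
    (repr (pi x) - x) * repr (pi y) + x * (repr (pi y) - y).
  by rewrite mulrBl mulrBr addrA subrK.
by apply: rpredD; [apply: vmaxMr|apply: vmaxMl]; apply: residue_reprB.
Qed.

Lemma residue_addE (x y : vring_type) : pi x + pi y = pi (x + y).
Proof. by rewrite [RHS](@Quotient.pi_add _ vmax). Qed.

Fact residue_mulA : associative residue_mul.
Proof.
move=> s t r; elim/residue_ind: s => x; elim/residue_ind: t => y; elim/residue_ind: r => z.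
by rewrite !residue_mulE mulrA.
Qed.
Fact residue_mul1l : left_id residue_one residue_mul.
Proof. by move=> s; elim/residue_ind: s => x; rewrite residue_mulE mul1r. Qed.
Fact residue_mul1r : right_id residue_one residue_mul.
Proof. by move=> s; elim/residue_ind: s => x; rewrite residue_mulE mulr1. Qed.
Fact residue_mulDl : left_distributive residue_mul +%R.
Proof.
move=> s t r; elim/residue_ind: s => x; elim/residue_ind: t => y; elim/residue_ind: r => z.
by rewrite residue_addE !residue_mulE residue_addE mulrDl.
Qed.
Fact residue_mulDr : right_distributive residue_mul +%R.
Proof.
move=> s t r; elim/residue_ind: s => x; elim/residue_ind: t => y; elim/residue_ind: r => z.
by rewrite residue_addE !residue_mulE residue_addE mulrDr.
Qed.
Fact residue_one_neq0 : residue_one != 0.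
Proof.
have -> : 0 = pi 0 by apply: (addrI (pi 0)); rewrite residue_addE !addr0.
by rewrite residue_eqE subr0 inE /= oner_eq0 v1 ltxx.
Qed.
HB.instance Definition _ := GRing.Zmodule_isNzRing.Build residue
  residue_mulA residue_mul1l residue_mul1r residue_mulDl residue_mulDr
  residue_one_neq0.

(* The value 0 outside the valuation ring is a dummy. *)
Definition bar (x : R) : residue :=
  if insub x : option vring_type is Some o then pi o else 0.

Lemma bar_val (o : vring_type) : bar (val o) = pi o.
Proof. by rewrite /bar valK. Qed.

Lemma barE x (xO : vge v 0 x) : bar x = pi (VRing xO).
Proof. by rewrite -bar_val. Qed.

Lemma bar_surj (t : residue) : exists2 x, vge v 0 x & bar x = t.
Proof. by elim/residue_ind: t => o; exists (val o); [exact: (valP o)|exact: bar_val]. Qed.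

Lemma barD x y : vge v 0 x -> vge v 0 y -> bar (x + y) = bar x + bar y.
Proof.
move=> xO yO; rewrite (barE xO) (barE yO) residue_addE -bar_val.
by rewrite rmorphD.
Qed.

Lemma barM x y : vge v 0 x -> vge v 0 y -> bar (x * y) = bar x * bar y.
Proof.
move=> xO yO; rewrite (barE xO) (barE yO).
by rewrite [RHS]residue_mulE -bar_val rmorphM.
Qed.

Lemma bar1 : bar 1 = 1.
Proof. by rewrite -[LHS]/(bar (val (1 : vring_type))) bar_val. Qed.

Lemma bar_eq x y : vge v 0 x -> vge v 0 y ->
  (bar x == bar y) = (x - y == 0) || (0 < v (x - y)).
Proof.
by move=> xO yO; rewrite (barE xO) (barE yO) residue_eqE inE.
Qed.

Lemma bar0 : bar 0 = 0.
Proof. by apply: (addrI (bar 0)); rewrite -barD ?addr0 // /vge eqxx. Qed.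

Lemma bar_eq0 x : vge v 0 x -> (bar x == 0) = (x == 0) || (0 < v x).
Proof. by move=> xO; rewrite -bar0 bar_eq ?subr0 // /vge eqxx. Qed.

Lemma residue_division : division_ring R -> division_ring residue.
Proof.
move=> divR t; have [x xO <-] := bar_surj t.
rewrite bar_eq0 // negb_or => /andP[x0 vx].
have vx0 : v x = 0.
  apply/eqP; rewrite eq_le; move: xO; rewrite /vge (negPf x0) /= => ->.
  by rewrite andbT leNgt.
have [y [xy yx]] := divR x x0.
have y0 : y != 0 by apply: contra_eq_neq xy => ->; rewrite mulr0 eq_sym oner_neq0.
have vy0 : v y = 0 by rewrite -[LHS]add0r -{1}vx0 -vM // xy v1.
have yO : vge v 0 y by rewrite /vge vy0 lexx orbT.
by exists (bar y); rewrite -!barM // xy yx bar1.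
Qed.
End ValuationTheory.

Section ResidueMap.
Variables (R S : nzRingType) (v : valuation R) (w : valuation S).
Variable f : {rmorphism R -> S}.
Hypothesis vge_f : forall q x, vge v q x -> vge w q (f x).

(* The dummy let keeps vge_f an argument, for the morphism instances below. *)
Definition residue_map (t : residue v) : residue w :=
  let _ := vge_f in bar w (f (val (repr t))).

Lemma residue_mapE x : vge v 0 x -> residue_map (bar v x) = bar w (f x).
Proof.
move=> xO; rewrite /residue_map; apply/eqP.
have rO : vge v 0 (val (repr (bar v x))) by apply: valP.
have : bar v (val (repr (bar v x))) == bar v x by rewrite bar_val reprK.
rewrite !bar_eq ?vge_f // -rmorphB => /orP[/eqP->|lt0].
  by rewrite rmorph0 eqxx.
have /vge_f/orP[->//|/(lt_le_trans lt0) ->] : vge v (v (val (repr (bar v x)) - x)) (val (repr (bar v x)) - x).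
  by rewrite /vge lexx orbT.
by rewrite orbT.
Qed.

Fact residue_map_zmod : zmod_morphism residue_map.
Proof.
move=> s t; have [x xO <-] := bar_surj s; have [y yO <-] := bar_surj t.
have barB (T : nzRingType) (z : valuation T) (c d : T) : vge z 0 c -> vge z 0 d ->
    bar z c - bar z d = bar z (c - d).
  move=> cO dO; apply/eqP; rewrite subr_eq; apply/eqP.
  by rewrite -barD ?subrK // vgeD ?vgeN.
by rewrite barB // !residue_mapE ?vgeD ?vgeN // barB ?vge_f // rmorphB.
Qed.

Fact residue_map_monoid : monoid_morphism residue_map.
Proof.
split; first by rewrite -bar1 residue_mapE ?rmorph1 ?bar1 // /vge v1 lexx orbT.
move=> s t; have [x xO <-] := bar_surj s; have [y yO <-] := bar_surj t.
have xyO : vge v 0 (x * y) by rewrite -[0]addr0 vgeM.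
by rewrite -barM // !residue_mapE // rmorphM barM ?vge_f.
Qed.

HB.instance Definition _ :=
  GRing.isZmodMorphism.Build _ _ residue_map residue_map_zmod.
HB.instance Definition _ :=
  GRing.isMonoidMorphism.Build _ _ residue_map residue_map_monoid.
End ResidueMap.

Section ResidueInvolution.
Variables (E : invDivRing) (v : valuation E).
Hypothesis v_star : forall x : E, v (star x) = v x.

Lemma vge_star q (x : E) : vge v q (star x) = vge v q x.
Proof. by rewrite /vge v_star star_eq0. Qed.

Definition residue_star (t : residue v) : residue v :=
  bar v (star (val (repr t))).

Lemma residue_starE x : vge v 0 x -> residue_star (bar v x) = bar v (star x).
Proof.
move=> xO; rewrite /residue_star; apply/eqP.
have rO : vge v 0 (val (repr (bar v x))) by apply: valP.
rewrite bar_eq ?vge_star // -starN -starD v_star star_eq0 -bar_eq //.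
by rewrite bar_val reprK.
Qed.

Fact residue_starD : {morph residue_star : s t / s + t}.
Proof.
move=> s t; have [x xO <-] := bar_surj s; have [y yO <-] := bar_surj t.
by rewrite -barD // !residue_starE ?vgeD // starD barD ?vge_star.
Qed.

Fact residue_starM s t : residue_star (s * t) = residue_star t * residue_star s.
Proof.
have [x xO <-] := bar_surj s; have [y yO <-] := bar_surj t.
have xyO : vge v 0 (x * y) by rewrite -[0]addr0 vgeM.
by rewrite -barM // !residue_starE // starM barM ?vge_star.
Qed.

Fact residue_starK : involutive residue_star.
Proof.
move=> t; have [x xO <-] := bar_surj t.
by rewrite !residue_starE ?vge_star // starK.
Qed.

Definition residue_inv : invDivRing :=
  InvDivRing (residue_division (@idr_div E))
    residue_starD residue_starM residue_starK.
End ResidueInvolution.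

Section Larmour.
Variables (E : invDivRing) (v : valuation E).
Hypothesis v_star : forall x : E, v (star x) = v x.
Variable eps : bool.

Definition unramified (h : hform E eps) : Prop :=
  exists (u : seq E) (u_ok : diag_ok eps u),
    (forall c, c \in u -> v c = 0) /\ isometric h (hdiag u_ok).

Definition larmour_map
    (d0 : Witt E eps -> Witt (residue_inv v_star) eps) : Prop :=
  forall (h : hform E eps) (u : seq E) (u_ok : diag_ok eps u),
    (forall c, c \in u -> v c = 0) -> isometric h (hdiag u_ok) ->
    exists ubar_ok : @diag_ok (residue_inv v_star) eps (map (bar v) u),
      d0 (witt_class h) = witt_class (hdiag ubar_ok).
End Larmour.

(* Quat p q r s stands for p + q x + r y + s z. *)
Record quat (K : fieldType) (a b : K) : Type :=
  Quat { q0 : K; qx : K; qy : K; qz : K }.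

Section Quaternion.
Variables (K : fieldType) (a b : K).
Local Notation H := (quat a b).
Local Notation Quat := (@Quat K a b).

Lemma quatP (d e : H) :
  [/\ q0 d = q0 e, qx d = qx e, qy d = qy e & qz d = qz e] -> d = e.
Proof. by case: d => ????; case: e => ???? /= [-> -> -> ->]. Qed.

Definition quat_tuple (d : H) : K * K * K * K := (q0 d, qx d, qy d, qz d).
Definition tuple_quat (t : K * K * K * K) : H :=
  let: (p, q, r, s) := t in Quat p q r s.
Fact quat_tupleK : cancel quat_tuple tuple_quat. Proof. by case. Qed.
HB.instance Definition _ := Choice.copy (quat a b) (can_type quat_tupleK).

Definition quat_zero : H := Quat 0 0 0 0.
Definition quat_opp (d : H) : H := Quat (- q0 d) (- qx d) (- qy d) (- qz d).
Definition quat_add (d e : H) : H :=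
  Quat (q0 d + q0 e) (qx d + qx e) (qy d + qy e) (qz d + qz e).

Fact quat_addA : associative quat_add.
Proof. by move=> d e f; apply: quatP; split=> /=; ring. Qed.
Fact quat_addC : commutative quat_add.
Proof. by move=> d e; apply: quatP; split=> /=; ring. Qed.
Fact quat_add0 : left_id quat_zero quat_add.
Proof. by move=> d; apply: quatP; split=> /=; ring. Qed.
Fact quat_addN : left_inverse quat_zero quat_opp quat_add.
Proof. by move=> d; apply: quatP; split=> /=; ring. Qed.
HB.instance Definition _ :=
  GRing.isZmodule.Build (quat a b) quat_addA quat_addC quat_add0 quat_addN.

Definition quat_scale (c : K) (d : H) : H :=
  Quat (c * q0 d) (c * qx d) (c * qy d) (c * qz d).

Fact quat_scaleA c c' d : quat_scale c (quat_scale c' d) = quat_scale (c * c') d.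
Proof. by apply: quatP; split=> /=; ring. Qed.
Fact quat_scale1 : left_id 1 quat_scale.
Proof. by move=> d; apply: quatP; split=> /=; ring. Qed.
Fact quat_scaleDr : right_distributive quat_scale +%R.
Proof. by move=> c d e; apply: quatP; split=> /=; ring. Qed.
Fact quat_scaleDl d : {morph quat_scale^~ d : c c' / c + c'}.
Proof. by move=> c c'; apply: quatP; split=> /=; ring. Qed.
HB.instance Definition _ := GRing.Zmodule_isLmodule.Build K (quat a b)
  quat_scaleA quat_scale1 quat_scaleDr quat_scaleDl.

Definition quat_one : H := Quat 1 0 0 0.
Definition quat_mul (d e : H) : H :=
  Quat (q0 d * q0 e + a * (qx d * qx e) + b * (qy d * qy e) - a * b * (qz d * qz e))
       (q0 d * qx e + qx d * q0 e - b * (qy d * qz e) + b * (qz d * qy e))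
       (q0 d * qy e + qy d * q0 e + a * (qx d * qz e) - a * (qz d * qx e))
       (q0 d * qz e + qz d * q0 e + qx d * qy e - qy d * qx e).

Fact quat_mulA : associative quat_mul.
Proof. by move=> d e f; apply: quatP; split=> /=; ring. Qed.
Fact quat_mul1l : left_id quat_one quat_mul.
Proof. by move=> d; apply: quatP; split=> /=; ring. Qed.
Fact quat_mul1r : right_id quat_one quat_mul.
Proof. by move=> d; apply: quatP; split=> /=; ring. Qed.
Fact quat_mulDl : left_distributive quat_mul +%R.
Proof. by move=> d e f; apply: quatP; split=> /=; ring. Qed.
Fact quat_mulDr : right_distributive quat_mul +%R.
Proof. by move=> d e f; apply: quatP; split=> /=; ring. Qed.
Fact quat_one_neq0 : quat_one != 0.
Proof. by apply/eqP => /(congr1 (@q0 K a b)) /eqP; rewrite oner_eq0. Qed.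

HB.instance Definition _ := GRing.Zmodule_isNzRing.Build (quat a b)
  quat_mulA quat_mul1l quat_mul1r quat_mulDl quat_mulDr quat_one_neq0.

Fact quat_scaleAl c (d e : H) : c *: (d * e) = (c *: d) * e.
Proof. by apply: quatP; split=> /=; ring. Qed.
Fact quat_scaleAr c (d e : H) : c *: (d * e) = d * (c *: e).
Proof. by apply: quatP; split=> /=; ring. Qed.

HB.instance Definition _ := GRing.Lmodule_isLalgebra.Build K (quat a b) quat_scaleAl.
HB.instance Definition _ := GRing.Lalgebra_isAlgebra.Build K (quat a b) quat_scaleAr.

Definition quat_x : H := Quat 0 1 0 0.
Definition quat_y : H := Quat 0 0 1 0.

Definition quat_conj (d : H) : H := Quat (q0 d) (- qx d) (- qy d) (- qz d).
Definition nrd (d : H) : K :=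
  q0 d ^+ 2 - a * qx d ^+ 2 - b * qy d ^+ 2 + a * b * qz d ^+ 2.

Lemma quat_mul_conj d : d * quat_conj d = (nrd d)%:A.
Proof. by apply: quatP; split=> /=; rewrite /nrd; ring. Qed.

Lemma quat_conj_mul d : quat_conj d * d = (nrd d)%:A.
Proof. by apply: quatP; split=> /=; rewrite /nrd; ring. Qed.

Lemma quat_conjD d e : quat_conj (d + e) = quat_conj d + quat_conj e.
Proof. by apply: quatP; split=> /=; ring. Qed.

Lemma quat_conjM d e : quat_conj (d * e) = quat_conj e * quat_conj d.
Proof. by apply: quatP; split=> /=; rewrite /nrd; ring. Qed.

Lemma quat_conjK : involutive quat_conj.
Proof. by move=> d; apply: quatP; split=> /=; ring. Qed.

Lemma nrdM d e : nrd (d * e) = nrd d * nrd e.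
Proof. by rewrite /nrd /=; ring. Qed.

Lemma nrd1 : nrd 1 = 1.
Proof. by rewrite /nrd /=; ring. Qed.

Lemma nrd0 : nrd 0 = 0.
Proof. by rewrite /nrd /=; ring. Qed.

Lemma nrd_conj d : nrd (quat_conj d) = nrd d.
Proof. by rewrite /nrd /=; ring. Qed.

Definition quat_unit : {pred H} := [pred d | nrd d != 0].
Definition quat_invr (d : H) : H :=
  if nrd d != 0 then (nrd d)^-1 *: quat_conj d else d.

Fact quat_mulVr : {in quat_unit, left_inverse 1 quat_invr *%R}.
Proof.
move=> d; rewrite inE /quat_invr => d0; rewrite d0 -scalerAl quat_conj_mul.
by rewrite scalerA mulVf // scale1r.
Qed.
Fact quat_mulrV : {in quat_unit, right_inverse 1 quat_invr *%R}.
Proof.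
move=> d; rewrite inE /quat_invr => d0; rewrite d0 -scalerAr quat_mul_conj.
by rewrite scalerA mulVf // scale1r.
Qed.
Fact quat_unitP (d e : H) : e * d = 1 /\ d * e = 1 -> d \in quat_unit.
Proof.
case=> _ /(congr1 nrd); rewrite nrdM nrd1 inE => /eqP.
by apply: contraTneq => ->; rewrite mul0r eq_sym oner_eq0.
Qed.
Fact quat_invr_out : {in [predC quat_unit], quat_invr =1 id}.
Proof. by move=> d; rewrite !inE negbK /quat_invr => ->. Qed.

HB.instance Definition _ := GRing.NzRing_hasMulInverse.Build (quat a b)
  quat_mulVr quat_mulrV quat_unitP quat_invr_out.

Lemma quat_trd (d : H) : d * d - (q0 d *+ 2) *: d + (nrd d)%:A = 0.
Proof. by apply: quatP; split=> /=; rewrite /nrd; ring. Qed.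

Lemma nrdD1 d : nrd (d + 1) = nrd d + q0 d *+ 2 + 1.
Proof. by rewrite /nrd /=; ring. Qed.

Lemma quat_x_neq0 : quat_x != 0.
Proof. by apply/eqP => /(congr1 (@qx K a b)) /eqP; rewrite oner_eq0. Qed.

Definition tau_x (d : H) : H := quat_x * quat_conj d * quat_x^-1.

Hypothesis divH : division_ring (quat a b).

Lemma quat_unit_neq0 (d : H) : d != 0 -> d \is a GRing.unit.
Proof. by move=> /divH[e [de ed]]; apply/unitrP; exists e. Qed.

Lemma nrd_neq0 (d : H) : d != 0 -> nrd d != 0.
Proof. exact: quat_unit_neq0. Qed.

Let xU : quat_x \is a GRing.unit := quat_unit_neq0 quat_x_neq0.

Lemma quat_conj_x : quat_conj quat_x = - quat_x.
Proof. by apply: quatP; split=> /=; ring. Qed.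

Lemma quat_conjV (d : H) : d \is a GRing.unit -> quat_conj d^-1 = (quat_conj d)^-1.
Proof.
move=> dU; have cdV : quat_conj d * quat_conj d^-1 = 1.
  by rewrite -quat_conjM mulVr //; apply: quatP; rewrite /= oppr0.
have cdU : quat_conj d \is a GRing.unit.
  by rewrite -[_ \is a _]/(nrd _ != 0) nrd_conj.
by apply: (mulrI cdU); rewrite cdV divrr.
Qed.

Fact tau_xD : {morph tau_x : d e / d + e}.
Proof. by move=> d e; rewrite /tau_x quat_conjD mulrDr mulrDl. Qed.

Fact tau_xM d e : tau_x (d * e) = tau_x e * tau_x d.
Proof. by rewrite /tau_x quat_conjM !mulrA mulrVK. Qed.

Fact tau_xK : involutive tau_x.
Proof.
move=> d; rewrite /tau_x !quat_conjM quat_conjK quat_conjV // quat_conj_x.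
by rewrite invrN !mulNr !mulrN opprK !mulrA divrr // mul1r mulrK.
Qed.

Definition quat_tau_x : invDivRing := InvDivRing divH tau_xD tau_xM tau_xK.

Lemma nrd_tau_x d : nrd (tau_x d) = nrd d.
Proof.
by rewrite /tau_x !nrdM nrd_conj mulrAC -nrdM divrr // nrd1 mul1r.
Qed.

Variable nu : valuation K.
Hypothesis nu_complete : valuation_complete nu.

Lemma vge_small_eq0 x : (forall N : nat, vge nu N%:R x) -> x = 0.
Proof.
move=> xN; apply/eqP; apply: contraT => x0.
have := xN (Num.bound `|nu x|); rewrite /vge (negPf x0) /= leNgt.
by rewrite (le_lt_trans (ler_norm _)) // archi_boundP ?normr_ge0.
Qed.

Lemma hensel_quadratic m : vge nu 0 m -> (m == 0) || (0 < nu m) ->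
  exists s, s = m + s ^+ 2.
Proof.
have [->|m0 _ /= e0] := eqVneq m 0; first by exists 0; rewrite expr0n addr0.
pose e := nu m; pose s k := iter k (fun s => m + s ^+ 2) 0.
have s_0 : s 0%N = 0 by [].
have s_S k : s k.+1 = m + s k ^+ 2 by [].
have se k : vge nu e (s k).
  elim: k => [|k IHk]; first by rewrite s_0 /vge eqxx.
  rewrite s_S vgeD //; first by rewrite /vge lexx orbT.
  by apply: (@vgeW _ _ (e + e)); [rewrite lerDl ltW|rewrite expr2 vgeM].
have sS k : vge nu (e *+ k.+1) (s k.+1 - s k).
  elim: k => [|k IHk].
    by rewrite s_S s_0 subr0 expr0n addr0 mulr1n /vge lexx orbT.
  rewrite s_S [X in _ - X]s_S opprD addrACA subrr add0r subr_sqr mulrSr.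
  by rewrite vgeM // vgeD.
have sC n k : vge nu (e *+ n) (s (n + k)%N - s n).
  elim: k => [|k IHk]; first by rewrite addn0 subrr /vge eqxx.
  rewrite addnS -[s _.+1](subrK (s (n + k)%N)) -addrA vgeD //.
  apply: vgeW (sS _); apply: ler_wpMn2l; first exact: ltW.
  by rewrite leqW // leq_addr.
have eN N : exists n0, forall n, (n0 <= n)%N -> N%:R <= e *+ n.
  exists (Num.bound (N%:R / e)) => n hn.
  rewrite -[e *+ n]mulr_natl -ler_pdivrMr //.
  apply: le_trans (ltW (archi_boundP _)) _; last by rewrite ler_nat.
  by rewrite divr_ge0 ?ler0n // ltW.
have [N|l sl] := nu_complete (u := s).
  have [n0 Hn0] := eN N; exists n0.
  have main i j : (n0 <= i)%N -> (i <= j)%N -> vge nu N%:R (s j - s i).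
    by move=> ni ij; rewrite -(subnKC ij); apply: vgeW (sC _ _); apply: Hn0.
  move=> i j ni nj; have [ij|/ltnW ji] := leqP i j; last exact: main.
  by rewrite -vgeN opprB main.
have lO : vge nu 0 l.
  have [n0 /(_ n0 (leqnn _)) H0] := sl 0.
  rewrite -[l](subKr (s n0)) vgeD ?vgeN //; apply: vgeW (se _); exact: ltW.
exists l; apply/eqP; rewrite -subr_eq0; apply/eqP/vge_small_eq0 => N.
have [n0 Hn0] := sl N.
have -> : l - (m + l ^+ 2) = - (s n0.+1 - l) + (s n0 - l) * (s n0 + l).
  by rewrite s_S; ring.
rewrite vgeD ?vgeN ?Hn0 // -[N%:R]addr0 vgeM ?Hn0 // vgeD //.
by apply: vgeW (se _); exact: ltW.
Qed.

Lemma trd_integral d : vge nu 0 (nrd d) -> vge nu 0 (q0 d *+ 2).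
Proof.
move=> nO; set t := q0 d *+ 2; set n := nrd d.
apply: contraT; rewrite /vge negb_or -ltNge => /andP[t0 nut].
have nuV : nu t^-1 = - nu t.
  by apply/eqP; rewrite -addr_eq0 -vM ?invr_eq0 // mulVf // v1.
have tV q : vge nu q n -> vge nu (q - nu t *+ 2) (n / t ^+ 2).
  move=> qn; rewrite vgeM // expr2 invfM mulr2n opprD vgeM //;
  by rewrite /vge nuV lexx orbT.
have mO : vge nu (- nu t *+ 2) (n / t ^+ 2).
  by have := tV 0 nO; rewrite add0r mulNrn.
have nt2 : 0 < - nu t *+ 2 by rewrite pmulrn_lgt0 // oppr_gt0.
have [||s sE] := @hensel_quadratic (n / t ^+ 2).
- exact: vgeW (ltW nt2) mO.
- by case/orP: mO => [->//|/(lt_le_trans nt2) ->]; rewrite orbT.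
pose r := t * s.
have rE : r * (t - r) = n.
  have -> : r * (t - r) = t ^+ 2 * (s - s ^+ 2) by rewrite /r; ring.
  by rewrite {1}sE addrK mulrC divfK // expf_neq0.
have rd : (d - r%:A) * (d - (t - r)%:A) = 0.
  rewrite -(quat_trd d) -/t -/n -rE.
  by apply: quatP; split=> /=; ring.
have [c dc] : exists c, d = c%:A.
  have [|dr] := eqVneq (d - r%:A) 0.
    by move/eqP; rewrite subr_eq0 => /eqP->; exists r.
  have /eqP := rd; rewrite (mulrI_eq0 _ (mulrI (quat_unit_neq0 dr))).
  by rewrite subr_eq0 => /eqP->; exists (t - r).
have tc : t = c + c by rewrite /t dc mulr2n /= mulr1.
have nc : n = c * c.
  by rewrite /n dc /nrd /=; ring.
have cO : vge nu 0 c.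
  move: nO; rewrite -/n nc /vge mulf_eq0 orbb.
  have [//|c0] := eqVneq c 0; rewrite /= vM // -mulr2n.
  by rewrite pmulrn_lge0.
have := vgeD cO cO; rewrite -tc /vge (negPf t0) /=.
by rewrite leNgt nut.
Qed.

Definition quat_nu (d : H) : rat := nu (nrd d) / 2.

Fact quat_nuM (d e : H) : d != 0 -> e != 0 -> quat_nu (d * e) = quat_nu d + quat_nu e.
Proof.
by move=> d0 e0; rewrite /quat_nu nrdM vM ?nrd_neq0 // mulrDl.
Qed.

Fact quat_nuD (d e : H) : d != 0 -> e != 0 -> d + e != 0 ->
  Num.min (quat_nu d) (quat_nu e) <= quat_nu (d + e).
Proof.
wlog le_ed : d e / quat_nu e <= quat_nu d => [Hw d0 e0 de0|d0 e0 de0].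
  have /orP[/Hw|/Hw] := le_total (quat_nu e) (quat_nu d); first exact.
  by rewrite minC addrC; apply=> //; rewrite addrC.
rewrite ge_min; apply/orP; right.
have eU := quat_unit_neq0 e0; pose f := d / e.
have f0 : f != 0 by apply: contra_neq d0 => f0; rewrite -(divrK eU d) -/f f0 mul0r.
have f1 : f + 1 != 0.
  apply: contra_neq de0 => f1.
  by rewrite -(divrK eU d) -/f -{2}[e]mul1r -mulrDl f1 mul0r.
have -> : d + e = (f + 1) * e by rewrite mulrDl mul1r divrK.
rewrite quat_nuM // lerDr; move: le_ed.
rewrite -{1}(divrK eU d) -/f quat_nuM // lerDr /quat_nu.
rewrite !pmulr_lge0 ?invr_gt0 // => nf0.
have nfO : vge nu 0 (nrd f) by rewrite /vge nf0 orbT.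
have := nrd_neq0 f1; have : vge nu 0 (nrd (f + 1)).
  rewrite nrdD1; apply: vgeD; first by apply: vgeD (trd_integral nfO).
  by rewrite /vge v1 lexx orbT.
by rewrite /vge => /orP[->|].
Qed.

Definition quat_val : valuation (quat a b) := Valuation quat_nuM quat_nuD.

Lemma quat_val_tau_x (d : quat_tau_x) :
  (quat_val : valuation quat_tau_x) (star d) = quat_val d.
Proof. by rewrite /= /quat_nu nrd_tau_x. Qed.

Lemma vge_quat_val q (c : K) :
  vge nu q c -> vge quat_val q (GRing.in_alg (quat a b) c).
Proof.
have [->|c0] := eqVneq c 0; first by move=> _; rewrite /= scale0r /vge eqxx.
rewrite /vge (negPf c0) /= => qc; apply/orP; right.
have -> : quat_nu (c%:A) = nu c.
  rewrite /quat_nu; have -> : nrd (c%:A) = c * c by rewrite /nrd /=; ring.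
  by rewrite vM // -mulr2n -(mulr_natr (nu c)) mulfK.
exact: qc.
Qed.

Definition residue_incl : {rmorphism residue nu -> residue quat_val} :=
  residue_map vge_quat_val.

End Quaternion.

Arguments quat_x {K} a b.
Arguments quat_tau_x {K a b} divH.
Arguments quat_val {K a b} divH {nu} nu_complete.
Arguments quat_val_tau_x {K a b} divH {nu} nu_complete d.
Arguments residue_incl {K a b} divH {nu} nu_complete.

(* Main.v *)
Require Import Defs.
From HB Require Import structures.
From mathcomp Require Import all_boot all_order all_algebra.
From mathcomp Require Import boolp ring lra.

Set Implicit Arguments.
Unset Strict Implicit.
Unset Printing Implicit Defensive.

Import Order.TTheory GRing.Theory Num.Theory.
Local Open Scope ring_scope.

(** The idea is to describe Witt groups by generators and relations, so that the
residue map and its inverse can both be defined on one-dimensional forms, with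
no lattices and no dimension theory over division rings.

Call [s] eps-symmetric when [s] is nonzero and [star s = (-1) ^+ eps * s]. In a
diagonal form one may replace [s] by [c s (star c)], permute entries, and replace a
pair [p, q] with [p + q] nonzero by [p + q, p + p q^-1 p]: these are the moves
of [chain]. They suffice to bring any represented value to the front
([chain_represent]), and to turn an isotropic form into one starting with
[s, -s] ([chain_isotropic]). Together with [metabolic_cancel] this empties the
diagonal of a metabolic form. Since a form of trivial Witt class is metabolic
([class0_metabolic]), the Witt group is presented by the classes of [<s>],
subject to [<c s (star c)> = <s>], [<-s> = - <s>] and
[<p> + <q> = <p + q> + <p + p q^-1 p>] ([witt_presentation]).

For a valued division ring [E] with involution, suppose that each eps-symmetric
[s] admits [c] such that [c s (star c)] is a unit. Then
[s |-> <bar (c s (star c))>] satisfies the three relations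
([larmour_residue_additive]); it extends to Larmour's map. If moreover
eps-symmetric units with the same residue are congruent, and residues lift, then
[bar s |-> <s>] satisfies the relations over the residue ring
([residue_lift_additive]), and extends to the inverse
([larmour_isomorphism]).

For [D = (a, pi)] with the involution fixing [y] and [z] and negating [x], the
skew elements are the multiples [alpha x] with [alpha] in [K] ([symm_quatP]).
Since [y x (star y) = - pi x], powers of [y] bring [alpha] to valuation 0
([quat_values]); two units [alpha], [beta] with the same residue differ by a
square of [K], because the residue characteristic is not 2 ([quat_hensel]). The
four coordinates of an integral element of [D] are integral, so that residues
are those of [p + q x] and the residue division ring is [k(xbar)]
([residue_fields]). *)

(** * Forms: elementary isometries, chain equivalence, diagonalization *)

Section Isometries.
Variables (E : invDivRing) (eps : bool).
Implicit Types (h m : hform E eps) (s : E).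

Lemma hZl h a x y : h (a *: x) y = a * h x y.
Proof. by rewrite -[a *: x]addr0 hlinear h0l addr0. Qed.

Lemma star_sign_mul (b : bool) (x y : E) :
  (-1) ^+ b * (star ((-1) ^+ b * star x) * y) = x * y.
Proof.
by case: b; rewrite ?expr0 ?expr1 ?mulN1r ?mul1r ?starN starK ?mulNr ?opprK.
Qed.

Lemma hZr h a x y : h x (a *: y) = h x y * star a.
Proof.
rewrite (hsym _ x) hZl starM (hsym x y).
by rewrite -[RHS](star_sign_mul eps (h x y) (star a)) !mulrA.
Qed.

(** Linearity is free: [F (a u + v) - a F u - F v] is orthogonal to the image of
[F], which is everything. *)
Lemma isometric_of_bij h h' (F : hspace h -> hspace h') G :
  cancel F G -> cancel G F -> (forall u v, h' (F u) (F v) = h u v) ->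
  isometric h h'.
Proof.
move=> FK GK Fh.
have Fl : linear F.
  move=> a u v; apply/eqP; rewrite -subr_eq0; apply/eqP/hnondeg => w.
  rewrite hDl hNl hDl -[w]GK hZl !Fh hlinear.
  by rewrite subrr.
pose FL := HB.pack_for {linear hspace h -> hspace h'} F
  (GRing.isLinear.Build _ _ _ _ F Fl).
by exists FL; split; first by exists G.
Qed.

Definition eps_symmetric (s : E) : Prop := s != 0 /\ star s = (-1) ^+ eps * s.

Local Notation symm := eps_symmetric.

Lemma symm_star s : symm s -> star s = if eps then - s else s.
Proof. by case=> _ ->; rewrite mulr_sign. Qed.

Lemma mulE_neq0 (a b : E) : a != 0 -> b != 0 -> a * b != 0.
Proof. by move=> a0 b0; apply: contra_neq a0; apply: idr_mulf_eq0l. Qed.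

Lemma symm_congr s c : symm s -> c != 0 -> symm (c * s * star c).
Proof.
move=> ss c0; split; first by rewrite !mulE_neq0 ?star_eq0 //; case: ss.
rewrite !starM starK (symm_star ss) mulr_sign.
by case: (eps); rewrite ?(mulNr, mulrN) mulrA.
Qed.

Lemma symm_opp s : symm s -> symm (- s).
Proof. by case=> s0 ss; split; rewrite ?oppr_eq0 // starN ss mulrN. Qed.

Lemma symmD p q : symm p -> symm q -> p + q != 0 -> symm (p + q).
Proof. by move=> [_ pp] [_ qq] ?; split; rewrite // starD pp qq mulrDr. Qed.

Lemma symm_inv q r : symm q -> q * r = 1 -> r * q = 1 -> symm r.
Proof.
move=> sq qr rq.
have r0 : r != 0 by apply: contra_eq_neq qr => ->; rewrite mulr0 eq_sym oner_neq0.
split=> //; rewrite mulr_sign.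
have : star r * star q = 1 by rewrite -starM qr star1.
rewrite (symm_star sq) => sqr1.
rewrite -[in RHS](mul1r r) -sqr1.
by case: (eps); rewrite ?mulrN ?mulNr -mulrA qr mulr1 ?opprK.
Qed.

(** The value [p + p q^-1 p] factors as [(q + p) q^-1 p], which is why it is nonzero. *)
Lemma symm_binary p q r : symm p -> symm q -> q * r = 1 -> r * q = 1 ->
  p + q != 0 -> symm (p + p * r * p).
Proof.
move=> sp sq qr rq pq; have sr := symm_inv sq qr rq.
split.
  have -> : p + p * r * p = (q + p) * r * p by rewrite mulrDl qr mulrDl mul1r.
  by rewrite !mulE_neq0 //; [rewrite addrC|case: sr|case: sp].
rewrite starD !starM (symm_star sp) (symm_star sr) mulr_sign.
by case: (eps); rewrite ?(mulNr, mulrN, opprK) -?opprD mulrA.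
Qed.

Lemma diag_ok_cons s u : diag_ok eps (s :: u) <-> symm s /\ diag_ok eps u.
Proof.
split=> [ok|[ss ok] c]; last by rewrite inE => /orP[/eqP->//|/ok].
by split=> [|c cu]; apply: ok; rewrite inE ?eqxx // cu orbT.
Qed.

Lemma diag_ok1 s : diag_ok eps [:: s] <-> symm s.
Proof. by rewrite diag_ok_cons; split=> [[]|]. Qed.

Section Line.
Variables (s : E) (ss : symm s).
(** The form [<s>] on the regular module rather than on row vectors of length one,
so that isometries between sums of lines can be written down on pairs of scalars. *)
Definition hline_val (a b : E^o) : E := a * s * star b.

Fact hline_linear (a : E) (u v w : E^o) :
  hline_val (a *: u + v) w = a * hline_val u w + hline_val v w.
Proof. by rewrite /hline_val !mulrDl /GRing.scale /= !mulrA. Qed.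

Fact hline_sym u v : hline_val v u = (-1) ^+ eps * star (hline_val u v).
Proof.
rewrite /hline_val !starM starK (symm_star ss) mulr_sign.
by case: (eps); rewrite ?(mulNr, mulrN, opprK) mulrA.
Qed.

Fact hline_nondeg u : (forall v, hline_val u v = 0) -> u = 0.
Proof.
move=> /(_ 1); rewrite /hline_val star1 mulr1; apply: idr_mulf_eq0l.
by case: ss.
Qed.

Definition hline : hform E eps := HForm hline_linear hline_sym hline_nondeg.
End Line.

Lemma hdiag_nil (ok : diag_ok eps [::]) h : isometric (hsum (hdiag ok) h) h.
Proof.
rewrite (Prop_irrelevance ok (@diag_ok_nil E eps)); exact: isometric_hsum0.
Qed.

Lemma hdiag_cons s (u : seq E) (ok : diag_ok eps (s :: u)) (ss : symm s)
    (ok' : diag_ok eps u) :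
  isometric (hdiag ok) (hsum (hline ss) (hdiag ok')).
Proof.
pose F (v : 'rV[E]_(size (s :: u))) : E^o * 'rV[E]_(size u) :=
  (v 0 ord0, \row_i v 0 (lift ord0 i)).
pose G (w : E^o * 'rV[E]_(size u)) : 'rV[E]_(size (s :: u)) :=
  \row_i (if unlift ord0 i is Some j then w.2 0 j else w.1).
apply: (@isometric_of_bij (hdiag ok) (hsum (hline ss) (hdiag ok')) F G).
- move=> v; apply/rowP=> i; rewrite mxE; case: unliftP => [j ->|->] //.
  by rewrite mxE.
- move=> [a w]; congr pair; first by rewrite mxE unlift_none.
  by apply/rowP=> i; rewrite !mxE liftK.
- move=> v w; rewrite /= /hsum_val /= /hline_val /hdiag_val big_ord_recl.
  by congr (_ + _); apply: eq_bigr => i _; rewrite !mxE.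
Qed.

Lemma hline_congr s c (ss : symm s) (ss' : symm (c * s * star c)) : c != 0 ->
  isometric (hline ss) (hline ss').
Proof.
move=> c0; have [d [cd dc]] := idr_div c0.
apply: (@isometric_of_bij (hline ss) (hline ss') (fun x : E^o => x * d : E^o)
         (fun x : E^o => x * c : E^o)).
- by move=> x /=; rewrite -mulrA dc mulr1.
- by move=> x /=; rewrite -mulrA cd mulr1.
move=> x y /=; rewrite /hline_val starM !mulrA -(mulrA x d c) dc mulr1.
by rewrite -(mulrA _ (star c)) -starM dc star1 mulr1.
Qed.

(** The vectors [(1, 1)] and [(1, - p q^-1)] of [<p, q>] are orthogonal, and take
the values [p + q] and [p + p q^-1 p]. *)
Lemma hline_binary p q r (sp : symm p) (sq : symm q) (spq : symm (p + q))
    (st : symm (p + p * r * p)) : q * r = 1 -> r * q = 1 ->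
  isometric (hsum (hline sp) (hline sq)) (hsum (hline spq) (hline st)).
Proof.
move=> qr rq; apply: isometric_sym.
have [d [pqd dpq]] := idr_div (proj1 spq).
(* F sends the basis to the two orthogonal vectors; G solves F for the second
   coordinate b, using that [x - y = b (1 + p q^-1) = b (p + q) q^-1]. *)
pose F (x : E^o * E^o) : E^o * E^o := (x.1 + x.2, x.1 - x.2 * p * r).
pose G (x : E^o * E^o) : E^o * E^o :=
  let b := (x.1 - x.2) * q * d in (x.1 - b, b).
have k1 : (1 + p * r) * (q * d) = 1.
  by rewrite mulrDl mul1r !mulrA -(mulrA p r) rq mulr1 -mulrDl addrC.
have k2 : q * d * (1 + p * r) = 1.
  have -> : 1 + p * r = (p + q) * r by rewrite mulrDl qr addrC.
  by rewrite !mulrA -(mulrA q d) dpq mulr1.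
apply: (@isometric_of_bij (hsum (hline spq) (hline st))
         (hsum (hline sp) (hline sq)) F G).
- move=> [x y]; rewrite /F /G /=.
  have -> : (x + y - (x - y * p * r)) * q * d = y.
    rewrite opprB addrC addrA subrK -mulrA -[y * p * r]mulrA -[X in _ + X]mulr1.
    by rewrite -mulrDr -mulrA [_ + 1]addrC k1 mulr1.
  by rewrite addrK.
- move=> [x y]; rewrite /F /G /= subrK; congr pair.
  set b := _ * d; have bE : b * (1 + p * r) = x - y.
    by rewrite /b -mulrA -mulrA [q * _]mulrA k2 mulr1.
  by rewrite -addrA -opprD -{1}[b]mulr1 -mulrA -mulrDr bE opprB addrC subrK.
move=> [x y] [z w]; rewrite /= /hsum_val /= /hline_val /F /=.
have rpE : star r * star p = r * p.
  rewrite (symm_star sp) (symm_star (symm_inv sq qr rq)).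
  by case: (eps); rewrite ?mulrNN.
rewrite !starD starN !starM (mulrA (star r)) rpE.
move: (star z) (star w) => Z W.
rewrite !(mulrDl, mulrDr, mulNr, mulrN, opprK) !mulrA.
rewrite -!(mulrA _ r q) -(mulrA _ q r) qr rq !mulr1.
rewrite [x * p * W + _]addrC [- _ + y * p * r * p * W]addrC.
rewrite (addrACA (x * p * Z)) (addrACA (x * q * Z)).
rewrite [LHS]addrACA -opprD subrr addr0.
by rewrite addrACA.
Qed.

Lemma hdiag_ext (u : seq E) (ok ok' : diag_ok eps u) : isometric (hdiag ok) (hdiag ok').
Proof. by rewrite (Prop_irrelevance ok ok'); apply: isometric_refl. Qed.

Lemma hdiag_cat (u w : seq E) (ok : diag_ok eps (u ++ w)) (oku : diag_ok eps u)
    (okw : diag_ok eps w) :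
  isometric (hdiag ok) (hsum (hdiag oku) (hdiag okw)).
Proof.
elim: u => [|s u IHu] in ok oku *.
  exact: isometric_trans (hdiag_ext ok okw) (isometric_sym (hdiag_nil oku _)).
have [/= ss ok'] := (diag_ok_cons s (u ++ w)).1 ok.
have [_ oku'] := (diag_ok_cons _ _).1 oku.
apply: isometric_trans (hdiag_cons ok ss ok') _.
apply: isometric_trans (isometric_hsum (isometric_refl _) (IHu ok' oku')) _.
apply: isometric_trans (isometric_hsumA _ _ _) _.
apply: isometric_hsum (isometric_refl _).
exact: isometric_sym (hdiag_cons oku ss oku').
Qed.

(** Recording how one diagonal form is turned into another, and not merely that the
two are isometric, is what lets functions of a single entry be summed over the
diagonal: only these moves have to be checked.
In [chain_binary], [r] is the inverse of [q]. *)
Inductive chain : seq E -> seq E -> Prop :=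
| chain_refl (u : seq E) : chain u u
| chain_trans w u t : chain u w -> chain w t -> chain u t
| chain_cons s u w : chain u w -> chain (s :: u) (s :: w)
| chain_swap s t u : chain [:: s, t & u] [:: t, s & u]
| chain_congr s c u : c != 0 -> chain (s :: u) (c * s * star c :: u)
| chain_binary p q r u : q * r = 1 -> r * q = 1 -> p + q != 0 ->
    chain [:: p, q & u] [:: p + q, p + p * r * p & u].

Lemma chain_size u w : chain u w -> size u = size w.
Proof. by elim=> //= [???? -> _ ->|??? _ ->]. Qed.

Lemma chain_ok u w : chain u w -> diag_ok eps u -> diag_ok eps w.
Proof.
elim=> //= {u w}.
- by move=> w u t _ IHu _ IHw /IHu.
- by move=> s u w _ IHu /diag_ok_cons[ss /IHu ok]; apply/diag_ok_cons.
- move=> s t u /diag_ok_cons[ss /diag_ok_cons[st ok]].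
  by apply/diag_ok_cons; split=> //; apply/diag_ok_cons.
- move=> s c u c0 /diag_ok_cons[ss ok]; apply/diag_ok_cons; split=> //.
  exact: symm_congr.
move=> p q r u qr rq pq /diag_ok_cons[sp /diag_ok_cons[sq ok]].
apply/diag_ok_cons; split; first exact: symmD.
by apply/diag_ok_cons; split=> //; apply: symm_binary qr rq pq.
Qed.

Lemma chain_isometric (u w : seq E) (oku : diag_ok eps u) (okw : diag_ok eps w) :
  chain u w -> isometric (hdiag oku) (hdiag okw).
Proof.
move=> uw; elim: uw oku okw => {u w}.
- exact: hdiag_ext.
- move=> w u t uw IHu wt IHw oku okt; have okw := chain_ok uw oku.
  exact: isometric_trans (IHu oku okw) (IHw okw okt).
- move=> s u w _ IHu oku okw.
  have [ss oku'] := (diag_ok_cons _ _).1 oku.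
  have [_ okw'] := (diag_ok_cons _ _).1 okw.
  apply: isometric_trans (hdiag_cons oku ss oku') _.
  apply: isometric_trans (isometric_sym (hdiag_cons okw ss okw')).
  exact: isometric_hsum (isometric_refl _) (IHu _ _).
- move=> s t u ok1 ok2.
  have [ss ok3] := (diag_ok_cons _ _).1 ok1.
  have [st ok4] := (diag_ok_cons _ _).1 ok2.
  have [_ ok] := (diag_ok_cons _ _).1 ok3.
  apply: isometric_trans (hdiag_cons ok1 ss ok3) _.
  apply: isometric_trans (isometric_hsum (isometric_refl _) (hdiag_cons ok3 st ok)) _.
  apply: isometric_sym; apply: isometric_trans (hdiag_cons ok2 st ok4) _.
  apply: isometric_trans (isometric_hsum (isometric_refl _) (hdiag_cons ok4 ss ok)) _.
  apply: isometric_trans (isometric_hsumA _ _ _) _.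
  apply: isometric_sym; apply: isometric_trans (isometric_hsumA _ _ _) _.
  exact: isometric_hsum (isometric_hsumC _ _) (isometric_refl _).
- move=> s c u c0 ok1 ok2.
  have [ss ok] := (diag_ok_cons _ _).1 ok1.
  have [ss' _] := (diag_ok_cons _ _).1 ok2.
  apply: isometric_trans (hdiag_cons ok1 ss ok) _.
  apply: isometric_trans (isometric_sym (hdiag_cons ok2 ss' ok)).
  exact: isometric_hsum (hline_congr _ _ c0) (isometric_refl _).
move=> p q r u qr rq pq ok1 ok2.
have [sp ok3] := (diag_ok_cons _ _).1 ok1.
have [spq ok4] := (diag_ok_cons _ _).1 ok2.
have [sq ok] := (diag_ok_cons _ _).1 ok3.
have [st _] := (diag_ok_cons _ _).1 ok4.
apply: isometric_trans (hdiag_cons ok1 sp ok3) _.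
apply: isometric_trans (isometric_hsum (isometric_refl _) (hdiag_cons ok3 sq ok)) _.
apply: isometric_sym; apply: isometric_trans (hdiag_cons ok2 spq ok4) _.
apply: isometric_trans (isometric_hsum (isometric_refl _) (hdiag_cons ok4 st ok)) _.
apply: isometric_trans (isometric_hsumA _ _ _) _.
apply: isometric_sym; apply: isometric_trans (isometric_hsumA _ _ _) _.
exact: isometric_hsum (hline_binary _ _ _ _ qr rq) (isometric_refl _).
Qed.

(** The value of the diagonal form on a vector, whose coordinates are indexed by
all of [nat] so that tails of vectors are easy to take. *)
Definition diag_norm (u : seq E) (v : nat -> E) : E :=
  \sum_(i < size u) v i * u`_i * star (v i).

Lemma diag_norm_cons s u v :
  diag_norm (s :: u) v =
  v 0%N * s * star (v 0%N) + diag_norm u (v \o succn).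
Proof. by rewrite /diag_norm big_ord_recl. Qed.

(** By induction on the diagonal: if the tail of the vector has a nonzero value, that
value can be brought to the front of the tail, and the binary move merges it with
the first entry. *)
Lemma chain_represent (u : seq E) v : diag_ok eps u -> diag_norm u v != 0 ->
  exists w, chain u (diag_norm u v :: w).
Proof.
elim: u v => [v _|s u IHu v].
  by rewrite /diag_norm big_ord0 eqxx.
move=> /diag_ok_cons[ss ok].
rewrite diag_norm_cons; set n := diag_norm u _; set c := v 0%N.
have [n0|n0] := eqVneq n 0.
  rewrite n0 addr0 => c0; exists u; apply: chain_congr.
  by apply: contra_neq c0 => ->; rewrite !mul0r.
have [w uw] := IHu _ ok n0.
have snw := chain_cons s uw.
have [c0|c0] := eqVneq c 0.
  rewrite c0 !mul0r add0r => _; exists (s :: w).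
  exact: chain_trans snw (chain_swap _ _ _).
have [r [nr rn]] := idr_div n0.
move=> cn; exists (c * s * star c + c * s * star c * r * (c * s * star c) :: w).
apply: chain_trans snw _; apply: chain_trans (chain_congr _ _ c0) _.
exact: chain_binary.
Qed.

(** If the tail of the vector has a nonzero value [n], the tail represents [n] and the
first entry contributes [-n]; otherwise the tail is itself isotropic. *)
Lemma chain_isotropic (u : seq E) v : diag_ok eps u -> diag_norm u v = 0 ->
  (exists2 i, (i < size u)%N & v i != 0) ->
  exists s w, chain u [:: s, - s & w].
Proof.
elim: u v => [v _ _ []//|s u IHu v].
move=> /diag_ok_cons[ss ok].
rewrite diag_norm_cons; set n := diag_norm u _; set c := v 0%N.
have [n0|n0] := eqVneq n 0.
  rewrite n0 addr0 => c0; have {}c0 : c = 0.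
    apply: contraTeq isT => c1.
    by have := symm_congr ss c1; rewrite c0 => -[]; rewrite eqxx.
  move=> [[|i] /= iu vi]; first by rewrite -/c c0 eqxx in vi.
  have [|t [w uw]] := IHu (v \o succn) ok n0; first by exists i.
  exists t, (s :: w).
  apply: chain_trans (chain_cons s uw) _; apply: chain_trans (chain_swap _ _ _) _.
  by apply: chain_cons; apply: chain_swap.
move=> cn _; have [w uw] := chain_represent ok n0.
have c0 : c != 0 by apply: contra_eq_neq cn => ->; rewrite !mul0r add0r.
exists n, w; apply: chain_trans (chain_cons s uw) _.
apply: chain_trans (chain_swap _ _ _) _; apply: chain_cons.
by move/eqP: cn; rewrite addr_eq0 => /eqP <-; apply: chain_congr.
Qed.

Lemma metabolic_isometric h h' : isometric h h' -> metabolic h -> metabolic h'.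
Proof.
move=> /isometric_sym[f [[g fK gK] fh]] [L HL].
exists (fun x : hspace h' => L (f x)) => x; rewrite HL; split=> H v Lv.
  by rewrite -fh; apply: H.
by rewrite -[v]gK fh; apply: H; rewrite gK.
Qed.

(** Symplectic reduction: from a Lagrangian [L] of the sum and the isotropic line
[N] spanned by [n 1 = (1, 1)], the image in [h] of the intersection of [L] with
the orthogonal of [N] is again a Lagrangian. *)
Lemma metabolic_cancel h s (ss : symm s) (ss' : symm (- s)) :
  metabolic (hsum h (hsum (hline ss) (hline ss'))) -> metabolic h.
Proof.
pose H : hform E eps := hsum h (hsum (hline ss) (hline ss')).
rewrite -/H => -[L HL].
pose n (c : E) : hspace H := (0, (c, c)).
have LZ (a : E) x : L x -> L (a *: x).
  rewrite !HL => Lx v Lv.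
  by rewrite hZl (Lx v Lv) mulr0.
have LB x y : L x -> L y -> L (x - y).
  by rewrite !HL => Lx Ly v Lv; rewrite hDl hNl Lx // Ly // subrr.
have nE x c : H x (n c) = (x.2.1 - x.2.2) * s * star c.
  rewrite /H /= /hsum_val /= /hsum_val /= h0r add0r /hline_val.
  by rewrite mulrN mulNr !mulrBl.
have uE u c x : H (u, (c, c)) x = h u x.1 + c * H (n 1) x.
  rewrite /H /= /hsum_val /= /hsum_val /= h0l add0r /hline_val.
  by rewrite !mul1r !mulrDr !mulrA.
exists (fun x : hspace h => exists c, L (x, (c, c))) => u; split.
  move=> [c Lu] v [d Lv]; have := (HL _).1 Lu _ Lv.
  by rewrite uE (hsym _ (n 1)) nE subrr !mul0r star0 !mulr0 addr0.
move=> Hu.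
have key x : L x -> H x (n 1) = 0 -> h u x.1 = 0.
  move=> Lx; rewrite nE star1 mulr1 => /(idr_mulf_eq0l (proj1 ss))/eqP.
  rewrite subr_eq0 => /eqP x2; apply: Hu; exists x.2.1.
  by case: x x2 Lx => a [b c] /= ->.
(* Given u orthogonal to the reduction, find c with (u, (c, c)) in L. If L is
   orthogonal to n 1, then c = 0 works; otherwise c is chosen to make (u, (c, c))
   orthogonal to a vector l of L which is not orthogonal to n 1. *)
have [[l Ll nl]|Nl] := pselect (exists2 l, L l & H l (n 1) != 0); last first.
  exists 0; apply/HL => x Lx; rewrite uE mul0r addr0; apply: key => //.
  by apply: contrapT => /eqP xn; apply: Nl; exists x.
have [d [ld dl]] := idr_div nl.
have nl' : H (n 1) l != 0.
  by rewrite hsym mulr_sign; case: ifP => _; rewrite ?oppr_eq0 star_eq0.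
have [d' [ld' dl']] := idr_div nl'.
exists (- (h u l.1 * d')); apply/HL; set x := (u, _) => y Ly.
have xl : H x l = 0 by rewrite uE mulNr -mulrA dl' mulr1 subrr.
pose b := H y (n 1) * d; pose z := y - b *: l.
have Lz : L z by apply: LB => //; apply: LZ.
have zn : H z (n 1) = 0.
  rewrite /z hDl hNl hZl /b -mulrA dl mulr1.
  by rewrite subrr.
have -> : y = z + b *: l by rewrite /z subrK.
rewrite hDr uE key // (hsym _ (n 1)) zn star0 !mulr0 !add0r.
by rewrite hsym hZl hsym xl star0 !mulr0 star0 mulr0.
Qed.

Lemma isometric_hsumAC h1 h2 h3 :
  isometric (hsum (hsum h1 h2) h3 : hform E eps) (hsum (hsum h1 h3) h2).
Proof.
apply: isometric_trans (isometric_sym (isometric_hsumA _ _ _)) _.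
apply: isometric_trans (isometric_hsumA _ _ _).
exact: isometric_hsum (isometric_refl _) (isometric_hsumC _ _).
Qed.

Lemma hdiag_cons2 s t (u : seq E) (ok : diag_ok eps [:: s, t & u]) (ss : symm s)
    (st : symm t) (ok' : diag_ok eps u) :
  isometric (hdiag ok) (hsum (hsum (hline ss) (hline st)) (hdiag ok')).
Proof.
have okt : diag_ok eps (t :: u) by apply/diag_ok_cons.
apply: isometric_trans (hdiag_cons ok ss okt) _.
apply: isometric_trans (isometric_hsumA _ _ _).
exact: isometric_hsum (isometric_refl _) (hdiag_cons okt st ok').
Qed.

(** A nonzero metabolic form is isotropic, because its Lagrangian cannot be zero: the
zero subspace is not its own orthogonal. *)
Lemma metabolic_chain (u : seq E) (ok : diag_ok eps u) :
  u != [::] -> metabolic (hdiag ok) ->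
  exists s w (okw : diag_ok eps w),
    chain u [:: s, - s & w] /\ metabolic (hdiag okw).
Proof.
move=> u0 mu.
have [v Lv v0] : exists2 v : 'rV[E]_(size u), hdiag ok v v = 0 & v != 0.
  case: mu => L HL.
  have [[v Lv v0]|nL] := pselect (exists2 v, L v & v != 0).
    by exists v => //; apply: (HL v).1.
  have L0 v : L v -> v = 0.
    by move=> Lv; apply: contrapT => /eqP v0; apply: nL; exists v.
  have : L (const_mx 1).
    by apply/HL => v /L0 ->; rewrite h0r.
  have k : (0 < size u)%N by rewrite lt0n size_eq0.
  move/L0/rowP/(_ (Ordinal k)); rewrite !mxE => /eqP.
  by rewrite oner_eq0.
(* diag_norm evaluates functions on nat, so v is extended by 0. *)
pose f i := if insub i is Some j then v 0 j else 0 : E.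
have fE (j : 'I_(size u)) : f j = v 0 j by rewrite /f valK.
have [||s [w uw]] := @chain_isotropic u f ok.
- by rewrite -Lv; apply: eq_bigr => i _; rewrite fE.
- have /rV0Pn[j vj] := v0; exists j; rewrite ?fE //.
exists s, w; have ok' := chain_ok uw ok.
have [ss ok2] := (diag_ok_cons _ _).1 ok'.
have [ss' okw] := (diag_ok_cons _ _).1 ok2.
exists okw; split=> //; apply: (@metabolic_cancel _ s ss ss').
apply: metabolic_isometric mu.
apply: isometric_trans (chain_isometric ok ok' uw) _.
apply: isometric_trans (hdiag_cons2 ok' ss ss' okw) _.
exact: isometric_hsumC.
Qed.

(** The planes [<s, -s>] of the metabolic summand are removed one at a time. *)
Lemma metabolic_cancel_diag h (u : seq E) (ok : diag_ok eps u) :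
  metabolic (hdiag ok) -> metabolic (hsum h (hdiag ok)) -> metabolic h.
Proof.
have [k] := ubnP (size u); elim: k => // k IHk in u ok *.
have [u0|u0] := eqVneq u [::].
  subst u => _ _; apply: metabolic_isometric.
  exact: isometric_trans (isometric_hsumC _ _) (hdiag_nil ok h).
move=> uk mu mhu; have [s [w [okw [uw mw]]]] := metabolic_chain u0 mu.
have ok' := chain_ok uw ok.
have [ss ok2] := (diag_ok_cons _ _).1 ok'.
have [ss' _] := (diag_ok_cons _ _).1 ok2.
apply: (IHk w okw) => //.
  by move: uk; rewrite (chain_size uw) /= ltnS => /ltnW.
apply: (@metabolic_cancel _ s ss ss'); apply: metabolic_isometric mhu.
have i1 := chain_isometric ok ok' uw.
have i2 := isometric_trans i1 (hdiag_cons2 ok' ss ss' okw).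
apply: isometric_trans (isometric_hsum (isometric_refl h) i2) _.
apply: isometric_trans (isometric_hsumA _ _ _) _.
exact: isometric_hsumAC.
Qed.

Section Diagonalization.
Hypothesis nontriv : exists d : E, d + (-1) ^+ eps * star d != 0.

(** Otherwise [h] is alternating and [h u v + (-1) ^+ eps * star (h u v) = 0] for all
[u] and [v]; as [h u v] takes every value, this contradicts the hypothesis on
[E], which excludes alternating forms. *)
Lemma anisotropic_vector h (x : hspace h) : x != 0 -> exists v, h v v != 0.
Proof.
move=> x0; apply: contrapT => Nv.
have hv v : h v v = 0 by apply: contrapT => /eqP v0; apply: Nv; exists v.
have [d dd] := nontriv.
have [y xy] : exists y, h x y != 0.
  apply: contrapT => Ny; move/eqP: x0; apply; apply: hnondeg => y.
  by apply: contrapT => /eqP y0; apply: Ny; exists y.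
have [r [yr ry]] := idr_div xy.
have zy : h ((d * r) *: x) y = d.
  by rewrite hZl -mulrA ry mulr1.
have := hv ((d * r) *: x + y); rewrite hDl !hDr !hv add0r addr0.
by rewrite (hsym _ y) zy => /eqP; rewrite (negPf dd).
Qed.

(** The orthogonal complement of an anisotropic vector [v] with nonzero [j]-th
coordinate is parametrised by the vectors with zero [j]-th coordinate, projected
orthogonally to [v]; this keeps the induction within row vectors. *)
Lemma diagonalization h : exists (u : seq E) (ok : diag_ok eps u), isometric h (hdiag ok).
Proof.
suff: forall n (c : cform E eps), cdim c = n ->
    exists (u : seq E) (ok : diag_ok eps u), isometric (hform_of_cform c) (hdiag ok).
  move=> /(_ _ (cform_of_hform h) erefl)[u [ok ch]]; exists u, ok.
  exact: isometric_trans (isometric_sym (cform_of_hformK h)) ch.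
elim=> [|n IHn] [m cv cl cs cn] /= mn; subst m.
  exists [::], (@diag_ok_nil E eps); exists idfun; split=> //=.
    exists id => //.
  move=> x y; rewrite /hdiag_val big_ord0; symmetry.
  by rewrite [x]thinmx0 -[RHS](@h0l _ _ (HForm cl cs cn) y).
pose h1 : hform E eps := HForm cl cs cn.
rewrite -[hform_of_cform _]/h1.
have [|v vv] := @anisotropic_vector h1 (const_mx 1).
  by apply/eqP => /rowP/(_ ord0); rewrite !mxE => /eqP; rewrite oner_eq0.
have sv : symm (h1 v v) by split=> //; rewrite {2}hsym mulrA -signr_addb addbb mul1r.
have /rV0Pn[j vj] : v != 0 by apply: contra_neq vv => ->; rewrite h0l.
have [d [vd dv]] := idr_div vj; have [e [ve ev]] := idr_div vv.
pose ins (w : 'rV[E]_n) : 'rV[E]_n.+1 :=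
  \row_i (if unlift j i is Some k then w 0 k else 0).
pose P w := ins w - (h1 (ins w) v * e) *: v.
have Pv w : h1 (P w) v = 0.
  by rewrite hDl hNl hZl -mulrA ev mulr1 subrr.
have vP w : h1 v (P w) = 0 by rewrite hsym Pv star0 mulr0.
have Pl a w w' : P (a *: w + w') = a *: P w + P w'.
  have insl : ins (a *: w + w') = a *: ins w + ins w'.
    apply/rowP=> i; rewrite !mxE; case: unliftP => [k _|_]; rewrite ?mxE //.
    by rewrite mulr0 addr0.
  rewrite /P insl hlinear scalerBr scalerA mulrDl mulrA scalerDl.
  by rewrite opprD addrACA.
pose g w w' := h1 (P w) (P w').
have gl a w w' z : g (a *: w + w') z = a * g w z + g w' z.
  by rewrite /g Pl hlinear.
have gs w z : g z w = (-1) ^+ eps * star (g w z) by rewrite /g hsym.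
pose F (x : E^o * 'rV[E]_n) : 'rV[E]_n.+1 := (x.1 : E) *: v + P x.2.
pose G (x : 'rV[E]_n.+1) : E^o * 'rV[E]_n :=
  let w := col' j (x - (x 0 j * d) *: v) in (x 0 j * d + h1 (ins w) v * e, w).
have GK : cancel G F.
  move=> x; rewrite /F /G /=; set w := col' j _.
  have -> : P w = x - (x 0 j * d) *: v - (h1 (ins w) v * e) *: v.
    rewrite /P; congr (_ - _); apply/rowP=> i; rewrite !mxE.
    case: unliftP => [k ->|->]; rewrite ?mxE //.
    by rewrite -mulrA dv mulr1 subrr.
  by rewrite -addrA -opprD -scalerDl [LHS]addrC subrK.
have gn w : (forall z, g w z = 0) -> w = 0.
  move=> gw; have P0 : P w = 0.
    apply: (@hnondeg _ _ h1) => x; rewrite -[x]GK /F hDr hZr Pv mul0r add0r.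
    exact: gw.
  have := congr1 (fun x : 'rV_n.+1 => x 0 j) P0.
  rewrite !mxE unlift_none add0r => /eqP; rewrite oppr_eq0 => /eqP.
  move=> /(idr_mulf_eq0l vj) c0.
  move: P0; rewrite /P c0 scale0r subr0 => ins0; apply/rowP=> k.
  have := congr1 (fun x : 'rV_n.+1 => x 0 (lift j k)) ins0.
  by rewrite !mxE liftK.
pose c : cform E eps := CForm gl gs gn.
have [u [ok cu]] := IHn c erefl.
have okv : diag_ok eps (h1 v v :: u) by apply/diag_ok_cons.
exists (h1 v v :: u), okv.
apply: isometric_trans (isometric_sym (hdiag_cons okv sv ok)).
apply: isometric_trans (isometric_hsum (isometric_refl _) cu).
apply: isometric_sym.
have orth a b p p' : h1 p v = 0 -> h1 v p' = 0 ->
    h1 (a *: v + p) (b *: v + p') = a * h1 v v * star b + h1 p p'.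
  by move=> pv vp; rewrite hDl !hDr !hZl !hZr pv vp mulr0 mul0r addr0 add0r mulrA.
have hF x y : h1 (F x) (F y) = hsum (hline sv) (hform_of_cform c) x y.
  exact: orth.
have FK : cancel F G.
  move=> x; apply/eqP; rewrite -subr_eq0; apply/eqP.
  apply: (@hnondeg _ _ (hsum (hline sv) (hform_of_cform c))) => y.
  by rewrite hDl hNl -!hF GK subrr.
exact: (@isometric_of_bij (hsum (hline sv) (hform_of_cform c)) h1 F G).
Qed.
End Diagonalization.
End Isometries.

(** * A presentation of the Witt group *)

Section WittPresentation.
Variables (E : invDivRing) (eps : bool).
Hypothesis nontriv : exists d : E, d + (-1) ^+ eps * star d != 0.
Local Notation symm := (eps_symmetric eps).

(** The value 0 outside the eps-symmetric elements is a dummy. *)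
Definition wline (s : E) : Witt E eps :=
  if pselect (diag_ok eps [:: s]) is left ok then witt_class (hdiag ok) else 0.

Lemma wlineE (s : E) (ok : diag_ok eps [:: s]) : wline s = witt_class (hdiag ok).
Proof.
rewrite /wline; case: pselect => // ok'; congr witt_class.
by rewrite (Prop_irrelevance ok ok').
Qed.

Lemma witt_class_isometric (h h' : hform E eps) :
  isometric h h' -> witt_class h = witt_class h'.
Proof. by move=> hh'; apply/witt_classP/witt_equiv_isometric. Qed.

Lemma witt_class_hsum (h h' : hform E eps) :
  witt_class (hsum h h') = witt_class h + witt_class h'.
Proof. by rewrite -witt_addE. Qed.

Lemma witt_class_cat (u w : seq E) (ok : diag_ok eps (u ++ w))
    (oku : diag_ok eps u) (okw : diag_ok eps w) :
  witt_class (hdiag ok) = witt_class (hdiag oku) + witt_class (hdiag okw).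
Proof. by rewrite -witt_class_hsum; apply/witt_class_isometric/hdiag_cat. Qed.

Lemma witt_class_diag (u : seq E) (ok : diag_ok eps u) :
  witt_class (hdiag ok) = \sum_(s <- u) wline s.
Proof.
elim: u ok => [|s u IHu] ok.
  by rewrite big_nil; apply: witt_class_isometric; apply: hdiag_ext.
have [ss oku] := (diag_ok_cons eps s u).1 ok.
have ok1 := (diag_ok1 eps s).2 ss.
by rewrite big_cons -(IHu oku) (wlineE ok1) -(@witt_class_cat [:: s] u ok).
Qed.

Lemma metabolic_class0 (h : hform E eps) : metabolic h -> witt_class h = 0.
Proof. by move=> mh; apply/witt_classP/witt_equiv_metabolic. Qed.

(** The defining relations of the Witt group in terms of one-dimensional forms. *)
Record witt_additive (A : zmodType) (phi : E -> A) : Prop := WittAdditive {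
  wa_congr : forall s c, symm s -> c != 0 -> phi (c * s * star c) = phi s;
  wa_opp : forall s, symm s -> phi (- s) = - phi s;
  wa_binary : forall p q r, symm p -> symm q -> q * r = 1 -> r * q = 1 ->
    p + q != 0 -> phi p + phi q = phi (p + q) + phi (p + p * r * p) }.

Lemma chain_class (u w : seq E) : chain u w -> diag_ok eps u ->
  \sum_(s <- u) wline s = \sum_(s <- w) wline s.
Proof.
move=> uw oku; have okw := chain_ok uw oku.
rewrite -(witt_class_diag oku) -(witt_class_diag okw).
exact/witt_class_isometric/chain_isometric.
Qed.

Lemma wline_additive : witt_additive wline.
Proof.
split=> [s c ss c0|s ss|p q r sp sq qr rq pq].
- have ok1 := (diag_ok1 eps s).2 ss.
  by have := chain_class (chain_congr s [::] c0) ok1; rewrite !big_seq1.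
- have ss' := symm_opp ss.
  have ok1 := (diag_ok1 eps s).2 ss; have ok2 := (diag_ok1 eps _).2 ss'.
  have ok : diag_ok eps [:: s; - s] by apply/diag_ok_cons.
  apply/eqP; rewrite -addr_eq0 addrC (wlineE ok1) (wlineE ok2).
  rewrite -(@witt_class_cat [:: s] [:: - s] ok) metabolic_class0 //.
  apply: (@metabolic_isometric _ _ (hsum (hopp (hdiag ok1)) (hdiag ok1))).
    apply: isometric_trans (isometric_sym (@hdiag_cat _ _ [:: s] [:: - s] ok ok1 ok2)).
    apply: isometric_trans (isometric_hsumC _ _) _.
    apply: isometric_hsum (isometric_refl _) _.
    exists idfun; split; first by exists id.
    move=> x y; rewrite /= /hopp_val /= /hdiag_val !big_ord1 /=.
    by rewrite mulrN mulNr.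
  exact: metabolic_hopp.
have ok : diag_ok eps [:: p; q] by apply/diag_ok_cons; split=> //; apply/diag_ok1.
have := chain_class (chain_binary [::] qr rq pq) ok.
by rewrite !big_cons !big_nil !addr0.
Qed.

(** The metabolic form added to [h] is diagonalised, then cancelled. *)
Lemma class0_metabolic (h : hform E eps) : witt_class h = 0 -> metabolic h.
Proof.
move=> /witt_classP[m [m' [mm mm' iso]]].
have [u [ok mu]] := diagonalization nontriv m.
apply: (@metabolic_cancel_diag _ _ h u ok); first exact: metabolic_isometric mm.
apply: metabolic_isometric mm'; apply: isometric_sym.
apply: isometric_trans (isometric_hsum (isometric_refl _) (isometric_sym mu)) _.
exact: isometric_trans iso (isometric_hsum0 _).
Qed.

Section Extension.
Variables (A : zmodType) (phi : E -> A).
Hypothesis phiP : witt_additive phi.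

Lemma chain_sum (u w : seq E) : chain u w -> diag_ok eps u ->
  \sum_(s <- u) phi s = \sum_(s <- w) phi s.
Proof.
elim=> {u w} //.
- by move=> w u t uw IHu _ IHw ok; rewrite IHu // IHw //; apply: chain_ok ok.
- by move=> s u w _ IHu /diag_ok_cons[_ ok]; rewrite !big_cons IHu.
- by move=> s t u _; rewrite !big_cons addrCA.
- by move=> s c u c0 /diag_ok_cons[ss _]; rewrite !big_cons wa_congr.
move=> p q r u qr rq pq /diag_ok_cons[sp /diag_ok_cons[sq _]].
by rewrite !big_cons !addrA (wa_binary phiP sp sq qr).
Qed.

(** Chain equivalence exhibits the diagonal as [s, -s] followed by a shorter metabolic
diagonal, and the values at [s] and [-s] cancel. *)
Lemma metabolic_sum (u : seq E) (ok : diag_ok eps u) :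
  metabolic (hdiag ok) -> \sum_(s <- u) phi s = 0.
Proof.
have [k] := ubnP (size u); elim: k => // k IHk in u ok *.
have [u0|u0 uk mu] := eqVneq u [::]; first by subst u; rewrite big_nil.
have [s [w [okw [uw mw]]]] := metabolic_chain u0 mu.
have /diag_ok_cons[ss _] := chain_ok uw ok.
rewrite (chain_sum uw ok) !big_cons (wa_opp phiP) // addNKr.
by apply: (IHk w okw) => //; move: uk; rewrite (chain_size uw) /= ltnS => /ltnW.
Qed.

(** The form [<u> - <w>] has trivial class, hence is metabolic. *)
Lemma sum_witt_class (u w : seq E) (oku : diag_ok eps u) (okw : diag_ok eps w) :
  witt_class (hdiag oku) = witt_class (hdiag okw) ->
  \sum_(s <- u) phi s = \sum_(s <- w) phi s.
Proof.
move=> uw.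
have okN : diag_ok eps (map -%R w).
  by move=> _ /mapP[s sw ->]; apply: symm_opp; exact: (okw s sw).
have ok : diag_ok eps (u ++ map -%R w).
  by move=> s; rewrite mem_cat => /orP[/oku|/okN].
have : metabolic (hdiag ok).
  apply: class0_metabolic.
  rewrite (witt_class_cat ok oku okN) uw !witt_class_diag big_map -big_split /=.
  rewrite big_seq big1 // => s sw; rewrite (wa_opp wline_additive) ?subrr //.
  exact: (okw s sw).
move/metabolic_sum; rewrite big_cat big_map /= => /eqP; rewrite addr_eq0 => /eqP ->.
rewrite -sumrN big_seq [RHS]big_seq; apply: eq_bigr => s sw.
by rewrite (wa_opp phiP) ?opprK //; exact: (okw s sw).
Qed.

(** Every class is that of a diagonal form, and the sum of [phi] over the diagonal
depends on the class only. *)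
Theorem witt_presentation :
  exists Phi : {additive Witt E eps -> A}, forall s, symm s -> Phi (wline s) = phi s.
Proof.
have rep (w : Witt E eps) :
    exists u, exists ok : diag_ok eps u, w = witt_class (hdiag ok).
  elim/witt_ind: w => h; have [u [ok hu]] := diagonalization nontriv h.
  by exists u, ok; apply: witt_class_isometric.
have [f fP] := choice rep.
pose Phi w := \sum_(s <- f w) phi s.
have PhiE (u : seq E) (ok : diag_ok eps u) :
    Phi (witt_class (hdiag ok)) = \sum_(s <- u) phi s.
  have [ok' fE] := fP (witt_class (hdiag ok)).
  exact: sum_witt_class (esym fE).
have PhiD : {morph Phi : w1 w2 / w1 + w2}.
  move=> w1 w2; have [u1 [ok1 ->]] := rep w1; have [u2 [ok2 ->]] := rep w2.
  have ok : diag_ok eps (u1 ++ u2).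
    by move=> s; rewrite mem_cat => /orP[/ok1|/ok2].
  by rewrite -(witt_class_cat ok) !PhiE big_cat.
have PhiB : zmod_morphism Phi.
  by move=> w1 w2; apply/eqP; rewrite eq_sym subr_eq -PhiD subrK.
exists (HB.pack_for {additive Witt E eps -> A} Phi
          (GRing.isZmodMorphism.Build _ _ Phi PhiB)).
move=> s /diag_ok1 ok; rewrite /= (wlineE ok) PhiE big_seq1 //.
Qed.
End Extension.

Lemma additive_wline_eq (A : zmodType) (f g : {additive Witt E eps -> A}) :
  (forall s, symm s -> f (wline s) = g (wline s)) -> f =1 g.
Proof.
move=> fg; elim/witt_ind=> h; have [u [ok hu]] := diagonalization nontriv h.
rewrite (witt_class_isometric hu) witt_class_diag !raddf_sum big_seq [RHS]big_seq.
by apply: eq_bigr => s su; apply: fg; exact: (ok s su).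
Qed.

End WittPresentation.

(** * Residues of one-dimensional forms and Larmour's isomorphism *)

Section Valuation.
Variables (R : nzRingType) (v : valuation R).
Implicit Types x y : R.

Lemma vge0 x : v x = 0 -> vge v 0 x.
Proof. by rewrite /vge => ->; rewrite lexx orbT. Qed.

Lemma barN x : vge v 0 x -> bar v (- x) = - bar v x.
Proof.
move=> xO; apply/eqP; rewrite -addr_eq0 -barD ?vgeN // addNr; exact/eqP/bar0.
Qed.

Lemma bar_unit x : vge v 0 x -> bar v x != 0 -> x != 0 /\ v x = 0.
Proof.
move=> xO; rewrite bar_eq0 // negb_or => /andP[x0]; move: xO.
rewrite /vge (negPf x0) /= -leNgt => vx vx'.
by split=> //; apply/eqP; rewrite eq_le vx vx'.
Qed.

Lemma v_inv x y : x * y = 1 -> v y = - v x.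
Proof.
move=> xy; have x0 : x != 0.
  by apply: contra_eq_neq xy => ->; rewrite mul0r eq_sym oner_neq0.
have y0 : y != 0 by apply: contra_eq_neq xy => ->; rewrite mulr0 eq_sym oner_neq0.
by apply/eqP; rewrite -addr_eq0 addrC -vM // xy v1.
Qed.

Lemma v_dominant x d : x != 0 -> (d != 0 -> v x < v d) ->
  x + d != 0 /\ v (x + d) = v x.
Proof.
move=> x0; have [->|d0 /(_ isT) xd] := eqVneq d 0; first by rewrite addr0.
have xd0 : x + d != 0.
  by apply: contraTneq xd => /eqP; rewrite addr_eq0 => /eqP ->; rewrite vN ltxx.
split=> //; apply/eqP; rewrite eq_le.
have := vD v x0 d0 xd0; rewrite (min_idPl (ltW xd)) => ->; rewrite andbT leNgt.
apply/negP=> lt; have := vD v xd0; rewrite -oppr_eq0 in d0.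
move=> /(_ _ d0); rewrite addrK vN => /(_ x0).
by rewrite leNgt lt_min lt xd.
Qed.

End Valuation.

Section Larmour.
Variables (E : invDivRing) (v : valuation E).
Hypothesis v_star : forall x : E, v (star x) = v x.
Variable eps : bool.
Local Notation Ebar := (residue_inv v_star).
Local Notation rbar x := (bar v x : Ebar).
Local Notation symm := (eps_symmetric eps).

Lemma bar_neq0 x : x != 0 -> v x = 0 -> rbar x != 0.
Proof. by move=> x0 vx; rewrite bar_eq0 ?vge0 // negb_or x0 vx ltxx. Qed.

(** [bar_unit] for the residue ring seen as a ring with involution; keeping the two
readings apart spares costly conversions between their structures. *)
Lemma rbar_unit x : vge v 0 x -> rbar x != 0 -> x != 0 /\ v x = 0.
Proof. exact: bar_unit. Qed.

Lemma star_bar x : vge v 0 x -> star (rbar x) = rbar (star x).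
Proof. exact: residue_starE. Qed.

Lemma v_congr c s : c != 0 -> s != 0 -> v (c * s * star c) = v s + v c *+ 2.
Proof.
move=> c0 s0; rewrite !vM ?mulE_neq0 ?star_eq0 // v_star mulr2n addrA.
by rewrite [v c + _]addrC.
Qed.

Lemma bar_symm s : symm s -> v s = 0 -> @eps_symmetric Ebar eps (bar v s).
Proof.
move=> ss vs; have sO := vge0 vs; split; first exact: bar_neq0 (proj1 ss) vs.
rewrite star_bar // (symm_star ss) mulr_sign.
by case: (eps); rewrite // barN.
Qed.

(** Reduction commutes with congruence, so that congruent units have congruent
residues. *)
Lemma bar_congr c s : vge v 0 c -> vge v 0 s ->
  rbar (c * s * star c) = rbar c * rbar s * star (rbar c).
Proof.
move=> cO sO; have csO : vge v 0 (c * s) by rewrite -[0]addr0 vgeM.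
by rewrite star_bar // !barM ?vge_star.
Qed.

(** The class of [<bar (c s (star c))>] for a chosen [c] making [c s (star c)] a unit;
by [larmour_residueE] the choice is immaterial. The value 0 is a dummy. *)
Definition larmour_residue (s : E) : Witt Ebar eps :=
  if pselect (exists c, c != 0 /\ v (c * s * star c) = 0) is left ex then
    wline eps (rbar (let c := sval (cid ex) in c * s * star c))
  else 0.

(** Two choices [b] and [c] differ by [c b^-1], which has valuation 0 because
[2 v b = - v s = 2 v c]; its residue is therefore a nonzero scalar by which the two
residues are congruent. *)
Lemma larmour_residueE s c : symm s -> c != 0 -> v (c * s * star c) = 0 ->
  larmour_residue s = wline eps (rbar (c * s * star c)).
Proof.
move=> ss c0 vc; rewrite /larmour_residue.
case: pselect => [ex|[]]; last by exists c.
case: (cid ex) => b /= [b0 vb]; have s0 := proj1 ss.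
have [d [bd db]] := idr_div b0.
have -> : c * s * star c = (c * d) * (b * s * star b) * star (c * d).
  rewrite starM !mulrA -(mulrA c d) db mulr1 -(mulrA _ (star b)) -starM db star1.
  by rewrite mulr1.
have d0 : d != 0 by apply: contra_eq_neq bd => ->; rewrite mulr0 eq_sym oner_neq0.
have vcd : v (c * d) = 0.
  rewrite vM // (v_inv v bd); move: vc vb; rewrite !v_congr //.
  by rewrite !mulr2n; lra.
rewrite (bar_congr (vge0 vcd) (vge0 vb)) (wa_congr (wline_additive _ _)) //.
  exact: bar_symm (symm_congr ss b0) vb.
by apply: bar_neq0; rewrite ?mulE_neq0.
Qed.

Lemma larmour_residue_unit s : symm s -> v s = 0 ->
  larmour_residue s = wline eps (rbar s).
Proof.
move=> ss vs; have := @larmour_residueE s 1 ss (oner_neq0 _).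
by rewrite mul1r star1 mulr1; apply.
Qed.

Section Residue.
Hypothesis values : forall s, symm s ->
  exists2 c, c != 0 & v (c * s * star c) = 0.

Lemma larmour_residue_congr s c : symm s -> c != 0 ->
  larmour_residue (c * s * star c) = larmour_residue s.
Proof.
move=> ss c0; have ss' := symm_congr ss c0.
have [b b0 vb] := values ss'.
rewrite (larmour_residueE ss' b0 vb).
have E1 : b * (c * s * star c) * star b = (b * c) * s * star (b * c).
  by rewrite starM !mulrA.
by rewrite E1 -(@larmour_residueE s (b * c)) ?mulE_neq0 // -E1.
Qed.

Lemma larmour_residue_opp s : symm s ->
  larmour_residue (- s) = - larmour_residue s.
Proof.
move=> ss; have [b b0 vb] := values ss; have ss' := symm_opp ss.
have E1 : b * - s * star b = - (b * s * star b) by rewrite mulrN mulNr.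
rewrite (larmour_residueE ss b0 vb) (larmour_residueE ss' b0) E1 ?vN //.
rewrite barN ?vge0 // (wa_opp (wline_additive _ _)) //.
exact: bar_symm (symm_congr ss b0) vb.
Qed.

(** A perturbation of higher valuation is invisible after scaling to a unit. *)
Lemma larmour_residue_close s d : symm s -> symm (s + d) ->
  (d != 0 -> v s < v d) -> larmour_residue (s + d) = larmour_residue s.
Proof.
move=> ss sd vd; have [b b0 vb] := values ss; have s0 := proj1 ss.
have [_ vsd] := v_dominant s0 vd.
have vb' : v (b * (s + d) * star b) = 0.
  by rewrite v_congr ?vsd -?v_congr //; case: sd.
rewrite (larmour_residueE ss b0 vb) (larmour_residueE sd b0 vb').
congr wline; apply/eqP; rewrite bar_eq ?vge0 // mulrDr mulrDl addrC addKr.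
have [->|d0] := eqVneq d 0; first by rewrite mulr0 mul0r eqxx.
by move: vb (vd d0); rewrite !v_congr // => /eqP; rewrite addr_eq0 => /eqP ->;
   rewrite -subr_gt0 opprK => ->; rewrite orbT.
Qed.

(** If [p + q] is a unit, this is the binary relation in the residue ring. Otherwise
[bar q = - bar p], so the left side vanishes; and [t = p + p r p] is
[- (p r) (p + q) star (p r)] up to the term [(p + q) r (p + q) r p], whose
valuation is twice that of [p + q], so the right side vanishes as well. *)
Lemma larmour_residue_binary0 p q r : symm p -> symm q -> q * r = 1 -> r * q = 1 ->
    p + q != 0 -> v p = 0 -> v q = 0 ->
  larmour_residue p + larmour_residue q =
  larmour_residue (p + q) + larmour_residue (p + p * r * p).
Proof.
move=> sp sq qr rq pq vp vq.
have sr := symm_inv sq qr rq; have st := symm_binary sp sq qr rq pq.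
have spq := symmD sp sq pq.
have vr : v r = 0 by rewrite (v_inv v qr) vq oppr0.
have p0 := proj1 sp; have q0 := proj1 sq; have r0 := proj1 sr.
have tE : p + p * r * p = (p + q) * r * p.
  by rewrite [p + q]addrC mulrDl qr mulrDl mul1r.
have tE' : p + p * r * p = p * r * (p + q).
  by rewrite mulrDr -(mulrA _ r q) rq mulr1 addrC.
have vt : v (p + p * r * p) = v (p + q).
  by rewrite tE !vM ?mulE_neq0 // vr vp !addr0.
have pO := vge0 vp; have qO := vge0 vq; have rO := vge0 vr.
rewrite (larmour_residue_unit sp vp) (larmour_residue_unit sq vq).
have pqO : vge v 0 (p + q) by apply: vgeD.
have [vpq|vpq] := eqVneq (v (p + q)) 0.
  rewrite (larmour_residue_unit spq vpq) (larmour_residue_unit st (etrans vt vpq)).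
  have prO : vge v 0 (p * r) by rewrite -[0]addr0 vgeM.
  have prpO : vge v 0 (p * r * p) by rewrite -[0]addr0 vgeM.
  have pqE : rbar (p + q) = rbar p + rbar q := barD pO qO.
  have tbarE : rbar (p + p * r * p) = rbar p + rbar p * rbar r * rbar p.
    rewrite -[rbar p * rbar r](barM pO rO) -[rbar (p * r) * _](barM prO pO).
    exact: barD.
  have qr' : rbar q * rbar r = 1 by rewrite -[LHS](barM qO rO) qr; exact: bar1.
  have rq' : rbar r * rbar q = 1 by rewrite -[LHS](barM rO qO) rq; exact: bar1.
  have pq' : rbar p + rbar q != 0 by rewrite -pqE; apply: bar_neq0.
  rewrite pqE tbarE.
  exact: (wa_binary (wline_additive _ _) (bar_symm sp vp) (bar_symm sq vq) qr' rq' pq').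
have {}vpq : 0 < v (p + q) by rewrite lt_def vpq; move: pqO; rewrite /vge (negPf pq).
have -> : rbar q = - rbar p.
  by apply/eqP; rewrite -addr_eq0 -barD 1?[q + p]addrC // bar_eq0 // vpq orbT.
rewrite (wa_opp (wline_additive _ _)); last exact: bar_symm.
rewrite subrr.
have pr0 : p * r != 0 by rewrite mulE_neq0.
have sprE : star (p * r) = r * p.
  rewrite starM (symm_star sr) (symm_star sp).
  by case: (eps); rewrite ?mulrNN.
have srE : (p + q) * r = 1 + p * r by rewrite mulrDl qr addrC.
pose e := (p + q) * r * ((p + q) * r * p).
have eE : p + p * r * p = - (p * r * (p + q) * star (p * r)) + e.
  rewrite /e -tE srE mulrDl mul1r sprE [RHS]addrC -!(mulrA (p * r) (p + q)).
  by rewrite [(p + q) * (r * p)]mulrA -tE addrK.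
have sn := symm_opp (symm_congr spq pr0).
have := @larmour_residue_close _ e sn; rewrite -eE => -> //.
  rewrite larmour_residue_opp; last exact: symm_congr.
  by rewrite larmour_residue_congr ?subrr.
move=> e0; rewrite vN v_congr //. 
have -> : v (p * r) = 0 by rewrite vM // vp vr.
rewrite mul0rn addr0 /e.
by rewrite !vM ?mulE_neq0 // vr vp !addr0 ltrDl.
Qed.

(** When the valuations of [p] and [q] differ, the term of smaller valuation dominates
each of [p + q] and [p + p r p]; as [p r p] is congruent to [q], these two sums have
the classes of [p] and [q], in one order or the other. When the valuations agree,
a single [c] scales both to units. *)
Lemma larmour_residue_binary p q r : symm p -> symm q -> q * r = 1 -> r * q = 1 ->
    p + q != 0 ->
  larmour_residue p + larmour_residue q =
  larmour_residue (p + q) + larmour_residue (p + p * r * p).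
Proof.
move=> sp sq qr rq pq.
have sr := symm_inv sq qr rq; have st := symm_binary sp sq qr rq pq.
have spq := symmD sp sq pq.
have vr := v_inv v qr.
have p0 := proj1 sp; have q0 := proj1 sq; have r0 := proj1 sr.
have pr0 : p * r != 0 by rewrite mulE_neq0.
have prE : p * r * p = p * r * q * star (p * r).
  rewrite starM (symm_star sr) (symm_star sp) -(mulrA p r q) rq mulr1.
  by case: (eps); rewrite ?mulrNN mulrA.
have vprp : v (p * r * p) = v p *+ 2 - v q.
  by rewrite !vM // vr addrAC mulr2n.
have [pq_lt|qp_lt|vpq] := ltgtP (v p) (v q).
- rewrite [larmour_residue (p + q)]larmour_residue_close // addrC addrC; congr (_ + _).
  rewrite [p + _]addrC larmour_residue_close 1?addrC //.
  + by rewrite prE larmour_residue_congr.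
  + by rewrite prE; apply: symm_congr.
  by rewrite vprp => _; move: pq_lt; rewrite mulr2n; lra.
- rewrite [p + q]addrC [larmour_residue (q + p)]larmour_residue_close //; last first.
    by rewrite addrC.
  rewrite addrC; congr (_ + _); symmetry; apply: larmour_residue_close => //.
  by rewrite vprp => _; move: qp_lt; rewrite mulr2n; lra.
have [c c0 vcp] := values sp; have [d [cd dc]] := idr_div c0.
have d0 : d != 0 by apply: contra_eq_neq cd => ->; rewrite mulr0 eq_sym oner_neq0.
have vcq : v (c * q * star c) = 0 by rewrite v_congr // -vpq -v_congr.
pose r' := star d * r * d.
have cd' : star d * star c = 1 by rewrite -starM cd star1.
have dc' : star c * star d = 1 by rewrite -starM dc star1.
have qr' : c * q * star c * r' = 1.
  by rewrite /r' !mulrA -(mulrA _ (star c)) dc' mulr1 -(mulrA c q) qr mulr1 cd.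
have rq' : r' * (c * q * star c) = 1.
  by rewrite /r' !mulrA -(mulrA _ d c) dc mulr1 -(mulrA _ r q) rq mulr1 cd'.
have pqE : c * p * star c + c * q * star c = c * (p + q) * star c.
  by rewrite mulrDr mulrDl.
have tE : c * p * star c + c * p * star c * r' * (c * p * star c) =
    c * (p + p * r * p) * star c.
  rewrite mulrDr mulrDl /r' !mulrA -(mulrA _ (star c)) dc' mulr1.
  by rewrite -(mulrA _ d c) dc mulr1.
have := @larmour_residue_binary0 (c * p * star c) (c * q * star c) r'.
rewrite tE pqE !larmour_residue_congr //; apply=> //; try exact: symm_congr.
by rewrite !mulE_neq0 ?star_eq0.
Qed.

Lemma larmour_residue_additive : witt_additive eps larmour_residue.
Proof.
split; [exact: larmour_residue_congr|exact: larmour_residue_opp|].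
exact: larmour_residue_binary.
Qed.
End Residue.

(** Scaling each entry of a diagonalisation. *)
Lemma every_unramified (nontriv : exists d : E, d + (-1) ^+ eps * star d != 0)
    (values : forall s, symm s -> exists2 c, c != 0 & v (c * s * star c) = 0)
    (h : hform E eps) : unramified v h.
Proof.
have [u [ok hu]] := diagonalization nontriv h.
have [w [uw vw]] : exists w, chain u w /\ forall c, c \in w -> v c = 0.
  elim: u ok {hu} => [|s u IHu] ok; first by exists [::]; split=> //; apply: chain_refl.
  have [ss oku] := (diag_ok_cons _ _ _).1 ok.
  have [w [uw vw]] := IHu oku; have [c c0 vc] := values s ss.
  exists (c * s * star c :: w); split; last first.
    by move=> e; rewrite inE => /orP[/eqP->|/vw].
  exact: chain_trans (chain_congr _ _ c0) (chain_cons _ uw).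
have okw := chain_ok uw ok; exists w, okw; split=> //.
exact: isometric_trans hu (chain_isometric ok okw uw).
Qed.

Section Lift.
Hypothesis hensel : forall p q, symm p -> symm q -> v p = 0 -> v q = 0 ->
  rbar p = rbar q -> exists2 c, c != 0 & q = c * p * star c.
Hypothesis lifting : forall t : Ebar, eps_symmetric eps t ->
  exists s, [/\ symm s, v s = 0 & rbar s = t].

(** The class of [<s>] for a chosen eps-symmetric unit [s] lifting [t]; the value 0 is a
dummy. *)
Definition residue_lift (t : Ebar) : Witt E eps :=
  if pselect (exists s, [/\ symm s, v s = 0 & rbar s = t]) is left ex then
    wline eps (sval (cid ex))
  else 0.

Lemma residue_lift_bar s : symm s -> v s = 0 ->
  residue_lift (rbar s) = wline eps s.
Proof.
move=> ss vs; rewrite /residue_lift.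
case: pselect => [ex|[]]; last by exists s.
case: (cid ex) => p /= [sp vp ps].
have [c c0 ->] := hensel sp ss vp vs ps.
by rewrite (wa_congr (wline_additive _ _)).
Qed.

(** Each relation over the residue ring is the reduction of the same relation between
lifts. *)
Lemma residue_lift_additive : witt_additive eps residue_lift.
Proof.
split=> [t b st b0|t st|t1 t2 rb st1 st2 tr rt t12].
- have [s [ss vs sE]] := lifting st.
  have [c cO cE] := bar_surj b.
  have [c0 vc] : c != 0 /\ v c = 0 by apply: rbar_unit; rewrite ?cE.
  have vcs : v (c * s * star c) = 0 by rewrite v_congr ?vs ?vc ?addr0 //; case: ss.
  rewrite -sE -cE -(bar_congr cO (vge0 vs)) !residue_lift_bar //.
    exact: (wa_congr (wline_additive _ _)).
  exact: symm_congr.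
- have [s [ss vs <-]] := lifting st.
  rewrite -[- _](barN (vge0 vs)) !residue_lift_bar ?vN //; last exact: symm_opp.
  exact: (wa_opp (wline_additive _ _)).
have [p [sp vp pE]] := lifting st1; have [q [sq vq qE]] := lifting st2.
have [r [qr rq]] := idr_div (proj1 sq).
have vr : v r = 0 by rewrite (v_inv v qr) vq oppr0.
have pO := vge0 vp; have qO := vge0 vq; have rO := vge0 vr.
have rE : rbar r = rb.
  rewrite -[LHS]mulr1 -tr mulrA -qE -[_ * rbar q](barM rO qO) rq.
  by rewrite [rbar 1]bar1 mul1r.
have prO : vge v 0 (p * r) by rewrite -[0]addr0 vgeM.
have prpO : vge v 0 (p * r * p) by rewrite -[0]addr0 vgeM.
have pqE : rbar (p + q) = t1 + t2 by rewrite -pE -qE; apply: barD.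
have tE : rbar (p + p * r * p) = t1 + t1 * rb * t1.
  rewrite -pE -rE -[rbar p * rbar r](barM pO rO) -[rbar (p * r) * _](barM prO pO).
  exact: barD.
have [pq0 vpq] : p + q != 0 /\ v (p + q) = 0 by apply: rbar_unit; rewrite ?vgeD ?pqE.
have st := symm_binary sp sq qr rq pq0.
have [_ vt] : p + p * r * p != 0 /\ v (p + p * r * p) = 0.
  apply: rbar_unit; rewrite ?vgeD // tE.
  by case: (symm_binary st1 st2 tr rt t12).
rewrite -tE -pqE -{1}pE -qE !residue_lift_bar //; last exact: symmD.
exact: (wa_binary (wline_additive _ _) sp sq qr rq pq0).
Qed.

(** The maps induced by [s |-> <bar s>] and [bar s |-> <s>] are inverse to each other on
the generators. *)
Theorem larmour_isomorphism :
  (forall s, symm s -> exists2 c, c != 0 & v (c * s * star c) = 0) ->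
  (exists d : E, d + (-1) ^+ eps * star d != 0) ->
  (exists d : Ebar, d + (-1) ^+ eps * star d != 0) ->
  exists d0 : {additive Witt E eps -> Witt Ebar eps},
    larmour_map d0 /\ bijective d0.
Proof.
move=> values ntE ntEbar.
have [d0 d0E] := witt_presentation ntE (larmour_residue_additive values).
have [l0 l0E] := witt_presentation ntEbar residue_lift_additive.
exists d0; split.
  move=> h u u_ok vu hu.
  have okbar : @diag_ok Ebar eps (map (bar v) u).
    by move=> _ /mapP[s su ->]; apply: bar_symm; [exact: (u_ok s su)|exact: vu].
  exists okbar; rewrite (witt_class_isometric hu) !witt_class_diag raddf_sum.
  rewrite big_map big_seq [RHS]big_seq; apply: eq_bigr => s su.
  by have ss : symm s := u_ok s su; rewrite d0E // larmour_residue_unit ?vu.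
exists l0.
  apply: (additive_wline_eq ntE (f := l0 \o d0) (g := idfun)) => s ss /=.
  have [c c0 vc] := values s ss; have sc := symm_congr ss c0.
  rewrite -(wa_congr (wline_additive _ _) ss c0) d0E // larmour_residue_unit //.
  by rewrite l0E ?residue_lift_bar //; apply: bar_symm.
apply: (additive_wline_eq ntEbar (f := d0 \o l0) (g := idfun)) => t st /=.
rewrite l0E //; have [s [ss vs sE]] := lifting st.
by rewrite -sE residue_lift_bar // d0E // larmour_residue_unit.
Qed.
End Lift.
End Larmour.

(** * The quaternion algebra (a, pi) *)

Section RamifiedQuaternion.
Variables (K : fieldType) (nu : valuation K).
Hypotheses (nu_norm : normalized nu) (nu_complete : valuation_complete nu).
Hypothesis char_k : 2%N \notin [pchar (residue nu)].
Variables (a pi : K).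
Hypotheses (a_unit : a != 0 /\ nu a = 0) (pi_unif : pi != 0 /\ nu pi = 1).
Hypothesis D_div : division_ring (quat a pi).

Local Notation H := (quat a pi).
Local Notation D := (quat_tau_x D_div).
Local Notation nuH := (quat_val D_div nu_complete).
Local Notation nuD := (nuH : valuation D).
Local Notation Dbar := (residue_inv (quat_val_tau_x D_div nu_complete)).
Local Notation x := (quat_x a pi).
Local Notation y := (quat_y a pi).
Local Notation incl := (residue_incl D_div nu_complete).

Lemma two_unit : (2 : K) != 0 /\ nu 2 = 0.
Proof.
have O1 : vge nu 0 1 by rewrite vge0 // v1.
apply: bar_unit; first by rewrite [2]mulr2n vgeD.
apply: contraNneq char_k => b2; rewrite inE /=.
by rewrite mulr2n -(bar1 nu) -barD // -mulr2n b2.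
Qed.

Lemma nu_int c : c != 0 -> nu c \is a Num.int.
Proof. by move=> c0; apply/nu_norm; exists c. Qed.

Lemma nu_half r c : vge nu r (c *+ 2) -> vge nu r c.
Proof.
have [t0 t2] := two_unit; rewrite -mulr_natr /vge mulf_eq0 (negPf t0) orbF.
by have [//|c0 /=] := eqVneq c 0; rewrite vM // t2 addr0.
Qed.

(** The conjugate has the same valuation, and [d + conj d = 2 (q0 d)]. *)
Lemma quat_vge_q0 r (d : H) : vge nuH r d -> vge nu r (q0 d).
Proof.
move=> dr; apply: nu_half.
have cr : vge nuH r (quat_conj d).
  move: dr; rewrite /vge /= /quat_nu nrd_conj => /orP[/eqP->|->]; last by rewrite orbT.
  by apply/orP; left; apply/eqP/quatP; rewrite /= oppr0.
have := vgeD dr cr.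
have -> : d + quat_conj d = (q0 d *+ 2)%:A by apply: quatP; split=> /=; ring.
set c := q0 d *+ 2; rewrite /vge; have [//|c0] := eqVneq c 0.
have -> : nuH (c%:A) = nu c.
  rewrite /= /quat_nu; have -> : nrd (c%:A : H) = c * c by rewrite /nrd /=; ring.
  by rewrite vM // -mulr2n -(mulr_natr (nu c)) mulfK.
have -> : (c%:A == 0 :> H) = false.
  by apply/eqP => /(congr1 (@q0 K a pi)) /eqP; rewrite /= mulr1 (negPf c0).
by [].
Qed.

Lemma quat_nu_x : nuH x = 0.
Proof.
rewrite /= /quat_nu; have -> : nrd x = - a by rewrite /nrd /=; ring.
by rewrite vN (proj2 a_unit) mul0r.
Qed.

Lemma quat_nu_y : nuH y = 1 / 2.
Proof.
rewrite /= /quat_nu; have -> : nrd y = - pi by rewrite /nrd /=; ring.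
by rewrite vN (proj2 pi_unif).
Qed.

Lemma quat_y_neq0 : y != 0.
Proof. by apply/eqP => /(congr1 (@qy K a pi)) /eqP; rewrite oner_eq0. Qed.

Lemma vge_self (R : nzRingType) (v : valuation R) c : vge v (v c) c.
Proof. by rewrite /vge lexx orbT. Qed.

(** [q0 (d x) = a (qx d)] with [x] a unit. *)
Lemma quat_vge_qx r (d : H) : vge nuH r d -> vge nu r (qx d).
Proof.
move=> dr; have := vgeM dr (vge_self nuH x); rewrite quat_nu_x addr0 => /quat_vge_q0.
have -> : q0 (d * x) = a * qx d by rewrite /=; ring.
have [a0 va] := a_unit; rewrite /vge mulf_eq0 (negPf a0) /=.
by have [//|c0 /=] := eqVneq (qx d) 0; rewrite vM // va add0r.
Qed.

(** [q0 (d y) = pi (qy d)] has valuation at least 1/2, hence at least 1, because the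
valuation of [K] takes integral values. *)
Lemma quat_vge_qy (d : H) : vge nuH 0 d -> vge nu 0 (qy d).
Proof.
move=> dr; have := vgeM dr (vge_self nuH y); rewrite quat_nu_y add0r => /quat_vge_q0.
have -> : q0 (d * y) = pi * qy d by rewrite /=; ring.
have [p0 vp] := pi_unif; rewrite /vge mulf_eq0 (negPf p0) /=.
have [//|c0 /=] := eqVneq (qy d) 0; rewrite vM // vp.
have /intrP[n ->] := nu_int c0 => nh.
have : (-1)%:~R < n%:~R :> rat by lra.
by rewrite ltr_int ler0z; case: n {nh}.
Qed.

Lemma quat_vge_qz (d : H) : vge nuH 0 d -> vge nu 0 (qz d).
Proof.
move=> dr; have := vgeM dr (vge_self nuH x); rewrite quat_nu_x addr0 => /quat_vge_qy.
have -> : qy (d * x) = - a * qz d by rewrite /=; ring.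
have [a0 va] := a_unit; rewrite mulNr vgeN /vge mulf_eq0 (negPf a0) /=.
by have [//|c0 /=] := eqVneq (qz d) 0; rewrite vM // va add0r.
Qed.

Lemma vge_quat (p q : K) : vge nu 0 p -> vge nu 0 q -> vge nuH 0 (p%:A + q *: x).
Proof.
move=> pO qO; rewrite vgeD ?(vge_quat_val D_div nu_complete pO) //.
have -> : q *: x = q%:A * x by rewrite -scalerAl mul1r.
rewrite -[0]addr0 vgeM ?(vge_quat_val D_div nu_complete qO) // -quat_nu_x.
exact: vge_self.
Qed.

(** The difference is an integral multiple of [y], of valuation at least 1/2. *)
Lemma bar_quat (d : H) : vge nuH 0 d -> bar nuH d = bar nuH ((q0 d)%:A + qx d *: x).
Proof.
move=> dO; have qyO := quat_vge_qy dO; have qzO := quat_vge_qz dO.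
have uO := vge_quat (quat_vge_q0 dO) (quat_vge_qx dO).
apply/eqP; rewrite bar_eq //.
have -> : d - ((q0 d)%:A + qx d *: x) = ((qy d)%:A + qz d *: x) * y.
  by apply: quatP; split=> /=; ring.
have [//|w0] := eqVneq (((qy d)%:A + qz d *: x) * y) 0.
have : vge nuH (0 + 1/2) (((qy d)%:A + qz d *: x) * y).
  by rewrite vgeM ?vge_quat // -quat_nu_y vge_self.
by rewrite /vge (negPf w0) => /(lt_le_trans _) ->.
Qed.

Lemma residue_quat (t : Dbar) : exists p q, [/\ vge nu 0 p, vge nu 0 q &
  t = bar nuH (p%:A + q *: x)].
Proof.
have [d dO <-] := bar_surj (t : residue nuH).
exists (q0 d), (qx d); split; [exact: quat_vge_q0|exact: quat_vge_qx|].
exact: bar_quat.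
Qed.

Lemma incl_bar p : vge nu 0 p -> incl (bar nu p) = bar nuH (p%:A).
Proof. exact: residue_mapE. Qed.

Lemma xO : vge nuH 0 x.
Proof. by rewrite -quat_nu_x vge_self. Qed.

Lemma bar_scale_x q : vge nu 0 q -> bar nuH (q *: x) = incl (bar nu q) * bar nuH x.
Proof.
move=> qO; rewrite incl_bar // -barM ?xO ?(vge_quat_val D_div nu_complete qO) //.
by rewrite -scalerAl mul1r.
Qed.

Lemma bar_quat_incl p q : vge nu 0 p -> vge nu 0 q ->
  bar nuH (p%:A + q *: x) = incl (bar nu p) + incl (bar nu q) * bar nuH x.
Proof.
move=> pO qO; rewrite -bar_scale_x // incl_bar // barD //.
  exact: (vge_quat_val D_div nu_complete pO).
have := vge_quat (_ : vge nu 0 0) qO; rewrite scale0r add0r; apply.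
by rewrite /vge eqxx.
Qed.

(** The coordinates of an element of positive valuation have positive valuation. In
particular the residue of [a] is not a square. *)
Lemma bar_quat_inj p q p' q' : vge nu 0 p -> vge nu 0 q -> vge nu 0 p' -> vge nu 0 q' ->
  bar nuH (p%:A + q *: x) = bar nuH (p'%:A + q' *: x) ->
  bar nu p = bar nu p' /\ bar nu q = bar nu q'.
Proof.
move=> pO qO p'O q'O /eqP; rewrite bar_eq ?vge_quat //.
set d := _ - _ => dpos.
have dp : q0 d = p - p' by rewrite /d /=; ring.
have dq : qx d = q - q' by rewrite /d /=; ring.
have [r r0 dr] : exists2 r, 0 < r & vge nuH r d.
  case/orP: dpos => [/eqP->|d0]; first by exists 1; rewrite // /vge eqxx.
  by exists (nuH d); rewrite // vge_self.
have pos c c' : vge nu 0 c -> vge nu 0 c' -> vge nu r (c - c') -> bar nu c = bar nu c'.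
  move=> cO c'O cr; apply/eqP; rewrite bar_eq //.
  by case/orP: cr => [->//|/(lt_le_trans r0) ->]; rewrite orbT.
split; apply: pos => //; first by rewrite -dp; apply: quat_vge_q0.
by rewrite -dq; apply: quat_vge_qx.
Qed.

Lemma tau_xE (d : H) : tau_x d = Quat a pi (q0 d) (- qx d) (qy d) (qz d).
Proof.
rewrite /tau_x; apply: (mulIr (quat_unit_neq0 D_div (quat_x_neq0 a pi))).
rewrite divrK ?(quat_unit_neq0 D_div (quat_x_neq0 a pi)) //.
by apply: quatP; split=> /=; ring.
Qed.

Lemma residue_fields :
  [/\ commutative (@GRing.mul Dbar),
      (bar nuH x : Dbar) ^+ 2 = incl (bar nu a),
      (forall t : Dbar, exists! p : residue nu * residue nu,
             t = incl p.1 + incl p.2 * bar nuH x),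
      (forall c : residue nu, star (incl c : Dbar) = incl c)
    & exists t : Dbar, star t != t].
Proof.
split.
- move=> s t; have [p [q [pO qO ->]]] := residue_quat s.
  have [p' [q' [p'O q'O ->]]] := residue_quat t.
  have h1 := vge_quat pO qO; have h2 := vge_quat p'O q'O.
  rewrite -[LHS](barM h1 h2) -[RHS](barM h2 h1); congr bar.
  by apply: quatP; split=> /=; ring.
- have aO : vge nu 0 a by rewrite vge0 //; case: a_unit.
  rewrite expr2 -[LHS](barM xO xO) incl_bar //; congr bar.
  by apply: quatP; split=> /=; ring.
- move=> t; have [p [q [pO qO ->]]] := residue_quat t.
  exists (bar nu p, bar nu q); split; first exact: bar_quat_incl.
  move=> [s s'] /=; have [P PO <-] := bar_surj s; have [Q QO <-] := bar_surj s'.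
  rewrite -[RHS](bar_quat_incl PO QO) => /bar_quat_inj[] // -> -> //.
- move=> c; have [p pO <-] := bar_surj c; rewrite incl_bar //.
  have pO' := vge_quat_val D_div nu_complete pO.
  rewrite (star_bar (quat_val_tau_x D_div nu_complete)) //; congr bar.
  by rewrite /= tau_xE; apply: quatP; split=> /=; ring.
exists (bar nuH x); rewrite (star_bar (quat_val_tau_x D_div nu_complete)) ?xO //.
apply/eqP => /eqP; rewrite /= tau_xE.
have -> : Quat a pi (q0 x) (- qx x) (qy x) (qz x) = 0%:A + (-1) *: x.
  by apply: quatP; split=> /=; ring.
have xE : x = 0%:A + 1 *: x by rewrite scale0r add0r scale1r.
have O0 : vge nu 0 0 by rewrite /vge eqxx.
have O1 : vge nu 0 1 by rewrite vge0 // v1.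
move/eqP; rewrite {2}xE => /bar_quat_inj[]; rewrite ?vgeN // => _ /eqP.
have [t0 t2] := two_unit.
rewrite bar_eq ?vgeN // (_ : -1 - 1 = - 2); last by ring.
by rewrite oppr_eq0 vN (negPf t0) t2 ltxx.
Qed.

Lemma symm_quatP (s : D) : eps_symmetric true s <-> exists2 c : K, c != 0 & s = c *: x.
Proof.
have [t0 _] := two_unit.
have half0 (c : K) : c = - c -> c = 0.
  move/eqP; rewrite -addr_eq0 -mulr2n -mulr_natr mulf_eq0 (negPf t0) orbF.
  by move/eqP.
split=> [[s0]|[c c0 ->]].
  rewrite expr1 mulN1r /= tau_xE => sE.
  have h0 := half0 _ (congr1 (@q0 K a pi) sE).
  have hy := half0 _ (congr1 (@qy K a pi) sE).
  have hz := half0 _ (congr1 (@qz K a pi) sE).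
  have E1 : s = qx s *: x.
    by apply: quatP; split; rewrite /= ?mulr0 ?mulr1 //.
  exists (qx s) => //; apply: contra_neq s0 => c0; rewrite E1 c0; exact: scale0r.
split.
  by apply/eqP => /(congr1 (@qx K a pi)) /eqP; rewrite /= mulr1 (negPf c0).
rewrite expr1 mulN1r /= tau_xE; apply: quatP; split=> /=; ring.
Qed.

Lemma quat_nu_scale_x (c : K) : c != 0 -> nuH (c *: x) = nu c.
Proof.
move=> c0; rewrite /= /quat_nu.
have -> : nrd (c *: x) = - (a * (c * c)) by rewrite /nrd /=; ring.
have [a0 va] := a_unit.
by rewrite vN !vM ?mulf_neq0 // va add0r -mulr2n -(mulr_natr (nu c)) mulfK.
Qed.

(** The powers of [y] realise all half-integers. *)
Lemma quat_nu_half_int (n : int) : exists2 c : H, c != 0 & nuH c *+ 2 = n%:~R.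
Proof.
have yn m : y ^+ m != 0 /\ nuH (y ^+ m) = (1 / 2) *+ m.
  elim: m => [|m [ym0 ymE]]; first by rewrite expr0 oner_neq0 v1.
  have y0 := quat_y_neq0; have ym : y ^+ m.+1 != 0.
    rewrite exprS; apply/eqP => /(@idr_mulf_eq0l D _ _ ym0)/eqP.
    by rewrite (negPf y0).
  by split=> //; rewrite exprS vM // ymE quat_nu_y -mulrS.
have two : (1 / 2) *+ 2 = 1 :> rat by [].
case: n => m; first by exists (y ^+ m); case: (yn m) => // _ ->; rewrite mulrnAC two.
have [y0 yE] := yn m.+1; have [c [yc cy]] := D_div y0.
exists c; first by apply: contra_eq_neq yc => ->; rewrite mulr0 eq_sym oner_neq0.
by rewrite (v_inv nuH yc) yE mulNrn mulrnAC two NegzE mulrNz.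
Qed.

Lemma quat_values (s : D) : eps_symmetric true s ->
  exists2 c : D, c != 0 & nuD (c * s * star c) = 0.
Proof.
move=> ss; have /symm_quatP[e e0 sE] := ss.
have /intrP[n nE] := nu_int e0.
have [c c0 cE] := quat_nu_half_int (- n); exists c => //.
rewrite (v_congr (quat_val_tau_x D_div nu_complete) c0 (proj1 ss)) cE sE.
by rewrite quat_nu_scale_x // nE mulrNz subrr.
Qed.

(** With [m = (e - f) / (4 e)] in the maximal ideal, a solution [g] of [g = m + g ^+ 2]
gives [(1 - 2 g) ^+ 2 = 1 - 4 m = f / e]; the scalar [1 - 2 g] is the congruence. *)
Lemma quat_hensel (s t : D) : eps_symmetric true s -> eps_symmetric true t ->
  nuD s = 0 -> nuD t = 0 -> bar nuD s = bar nuD t ->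
  exists2 c : D, c != 0 & t = c * s * star c.
Proof.
move=> /symm_quatP[e e0 ->] /symm_quatP[f f0 ->].
rewrite !quat_nu_scale_x // => ve vf ef.
have [t0 t2] := two_unit.
have O0 : vge nu 0 0 by rewrite /vge eqxx.
have addx (c : K) : c *: x = 0%:A + c *: x by rewrite scale0r add0r.
move: ef; rewrite (addx e) (addx f) => /bar_quat_inj[] //; try exact: vge0.
move=> _ /eqP; rewrite bar_eq ?vge0 //; set d := e - f => dpos.
have four0 : 2 * 2 * e != 0 by rewrite !mulf_neq0.
have v4 : nu (2 * 2 * e) = 0 by rewrite !vM ?mulf_neq0 // t2 ve !addr0.
pose m := d / (2 * 2 * e).
have mpos : (m == 0) || (0 < nu m).
  rewrite /m mulf_eq0 invr_eq0 (negPf four0) orbF.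
  case/orP: dpos => [->//|dpos]; have [//|d0] := eqVneq d 0.
  by rewrite vM ?invr_eq0 // (v_inv nu (mulfV four0)) v4 oppr0 addr0.
have mO : vge nu 0 m by rewrite /vge; case/orP: mpos => [->//|/ltW ->]; rewrite orbT.
have [g gE] := hensel_quadratic nu_complete mO mpos.
pose c := 1 - 2 * g.
have cE : c * e * c = f.
  have : c * e * c = e - 2 * 2 * e * (g - g ^+ 2) by rewrite /c; ring.
  rewrite {1}gE addrK [2 * 2 * e * m]mulrC /m divfK // => ->.
  by rewrite /d opprB addrC subrK.
exists (c%:A : H).
  apply/eqP => /(congr1 (@q0 K a pi)); rewrite /= mulr1 => c0.
  by move/eqP: f0; apply; rewrite -cE c0 mulr0.
rewrite -cE /= tau_xE; apply: quatP; split=> /=; ring.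
Qed.

(** Writing [t] as the residue of [p + q x], skewness forces the residue of [p] to
vanish, and [q x] is the lift. *)
Lemma bar_symm_lift (t : Dbar) : eps_symmetric true t ->
  exists s : D, [/\ eps_symmetric true s, nuD s = 0 & bar nuD s = t].
Proof.
move=> [t0]; have [p [q [pO qO tE]]] := residue_quat t.
rewrite expr1 mulN1r tE => st.
have [two0 two2] := two_unit.
have O0 : vge nu 0 0 by rewrite /vge eqxx.
have dO := vge_quat pO qO.
have /bar_quat_inj[||||pN _] //:
    bar nuH (p%:A + (- q) *: x) = bar nuH ((- p)%:A + (- q) *: x).
  rewrite -[RHS]/(bar nuH _); move: st.
  rewrite (star_bar (quat_val_tau_x D_div nu_complete) dO).
  rewrite -[X in _ = X](barN dO) /= tau_xE.
  have -> : Quat a pi (q0 (p%:A + q *: x : H)) (- qx (p%:A + q *: x : H))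
     (qy (p%:A + q *: x : H)) (qz (p%:A + q *: x : H)) = p%:A + (- q) *: x.
    by apply: quatP; split=> /=; ring.
  by move=> ->; congr bar; apply: quatP; split=> /=; ring.
- by rewrite vgeN.
- by rewrite vgeN.
- by rewrite vgeN.
have p0 : bar nu p = 0.
  move/eqP: pN; rewrite bar_eq ?vgeN // opprK -mulr2n -mulr_natr => pN.
  apply/eqP; rewrite bar_eq0 //; move: pN; rewrite mulf_eq0 (negPf two0) orbF.
  by have [//|p0] := eqVneq p 0; rewrite vM // two2 addr0.
have tq : t = bar nuH (q *: x).
  by rewrite tE bar_quat_incl // p0 rmorph0 add0r bar_scale_x.
have qxO : vge nuH 0 (q *: x).
  by have := vge_quat O0 qO; rewrite scale0r add0r.
rewrite tq in t0.
have [qx0 vq] := @rbar_unit _ nuD (quat_val_tau_x D_div nu_complete) _ qxO t0.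
exists (q *: x); split; [|exact: vq|by rewrite -tE -tq].
apply/symm_quatP; exists q => //.
by apply: contra_neq qx0 => ->; rewrite scale0r.
Qed.

Lemma quat_x_double : x + x != 0 /\ nuH (x + x) = 0.
Proof.
have [t0 t2] := two_unit.
have -> : x + x = 2 *: x by rewrite -mulr2n scaler_nat.
rewrite quat_nu_scale_x // t2; split=> //.
by apply/eqP => /(congr1 (@qx K a pi)) /eqP; rewrite /= mulr1 (negPf t0).
Qed.

Lemma star_quat_x : star (x : D) = - x.
Proof. by rewrite /= tau_xE; apply: quatP; split=> /=; ring. Qed.

Lemma quat_nontriv : exists d : D, d + (-1) ^+ true * star d != 0.
Proof.
exists x; rewrite star_quat_x expr1 mulN1r opprK.
by case: quat_x_double.
Qed.

Lemma residue_quat_nontriv : exists d : Dbar, d + (-1) ^+ true * star d != 0.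
Proof.
exists (bar nuH x); rewrite (star_bar (quat_val_tau_x D_div nu_complete)) ?xO //.
rewrite star_quat_x expr1 mulN1r -[- _](barN (_ : vge nuH 0 (- x))) ?vgeN ?xO //.
rewrite opprK -[X in X != _](barD xO xO).
have [d0 vd] := quat_x_double.
exact: (bar_neq0 (quat_val_tau_x D_div nu_complete) d0 vd).
Qed.
End RamifiedQuaternion.

Theorem mainTheorem13
  (K : fieldType) (nu : valuation K)
  (nu_norm : normalized nu) (nu_complete : valuation_complete nu)
  (char_k : 2%N \notin [pchar (residue nu)])
  (a pi : K)
  (a_unit : a != 0 /\ nu a = 0) (pi_unif : pi != 0 /\ nu pi = 1)
  (D_div : division_ring (quat a pi)) :
  let D := quat_tau_x D_div in
  let nuD : valuation D := quat_val D_div nu_complete in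
  let Dbar := residue_inv (quat_val_tau_x D_div nu_complete) in
  let x : quat a pi := quat_x a pi in
  let xbar : Dbar := bar nuD x in
  let incl : {rmorphism residue nu -> Dbar} := residue_incl D_div nu_complete in
  [/\ (* Dbar is the quadratic field extension k(xbar) of k, xbar^2 = abar,
         and its involution is the nontrivial k-automorphism *)
      [/\ commutative (@GRing.mul Dbar),
          xbar ^+ 2 = incl (bar nu a),
          (forall t : Dbar, exists! p : residue nu * residue nu,
             t = incl p.1 + incl p.2 * xbar),
          (forall c : residue nu, star (incl c) = incl c)
        & exists t : Dbar, star t != t],
      (forall h : hform D true, unramified nuD h)
    & exists d0 : {additive Witt D true -> Witt Dbar true},
        [/\ larmour_map d0,
            bijective d0
          & forall alpha : K, alpha != 0 -> nu alpha = 0 ->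
              exists (ok : @diag_ok D true [:: alpha *: x])
                     (okbar : @diag_ok Dbar true [:: incl (bar nu alpha) * xbar]),
                d0 (witt_class (hdiag ok)) = witt_class (hdiag okbar)]].
Proof.
move=> D nuD Dbar x xbar incl.
have values :=
  quat_values nu_norm nu_complete char_k a_unit pi_unif (D_div := D_div).
have nt := quat_nontriv nu_complete char_k a_unit D_div.
split; first exact: residue_fields.
  exact: every_unramified.
have [d0 [d0L d0B]] := larmour_isomorphism
  (quat_hensel (nu_complete := nu_complete) char_k a_unit (D_div := D_div))
  (bar_symm_lift nu_norm (nu_complete := nu_complete)
    char_k a_unit pi_unif (D_div := D_div))
  values nt (residue_quat_nontriv nu_complete char_k a_unit D_div).
exists d0; split=> // alpha alpha0 valpha.
have ok : @diag_ok D true [:: alpha *: x].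
  by apply/diag_ok1; apply: (symm_quatP char_k (_ : D)).2; exists alpha.
exists ok.
have [|okbar E] := d0L (hdiag ok) _ ok _ (isometric_refl _).
  by move=> c; rewrite inE => /eqP->; rewrite -valpha; apply: quat_nu_scale_x.
have bE : bar nuD (alpha *: x) = incl (bar nu alpha) * xbar.
  by apply: bar_scale_x => //; apply: vge0.
rewrite -bE; by exists okbar.
Qed.
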